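(* Let $n,m\ge1$, $p_{n,m}$ stable of degree $n$ in $z$ and $m$ in $w$, and $a_0,\dots,a_{m-1}$ as in the context. In $L^2\!\left(\frac{d\sigma}{|p_{n,m}|^2}\right)$, $$\overline{\operatorname{span}}\{z^ia_j: i\ge0,\ 0\le j<m\}=\overline{\operatorname{span}}\{z^iw^j: i\ge0,\ 0\le j<m\}\ominus\operatorname{span}\{z^iw^j:0\le i<n,\ 0\le j<m\},$$ and this space is orthogonal to $\overline{\operatorname{span}}\{z^iw^j: i<n,\ j\ge0\}$ ($i\in\mathbb{Z}$).
   Context: $\sigma$ is normalized Lebesgue measure on $\mathbb{T}^2$; $p_{n,m}$ is stable if it has no zeros in $\{|z|\le1,|w|\le1\}$. Inner product $\langle f,g\rangle=\int_{\mathbb{T}^2}f\bar g\,\frac{d\sigma}{|p_{n,m}|^2}$; $\overline{\operatorname{span}}$ and $\ominus$ (orthogonal complement within the first space) refer to this inner product. $\tilde p_{n,m}(z,w)=z^nw^m\overline{p_{n,m}(1/\bar z,1/\bar w)}$; $L(z,w;\eta)=z^n\frac{p_{n,m}(z,w)\overline{p_{n,m}(1/\bar z,\eta)}-\tilde p_{n,m}(z,w)\overline{\tilde p_{n,m}(1/\bar z,\eta)}}{1-w\bar\eta}$, a polynomial in $z,w,\bar\eta$, and $a_j$ are defined by $L=\sum_{j=0}^{m-1}a_j(z,w)\bar\eta^j$. *)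

(* Defs.v *)
From HB Require Import structures.
From mathcomp Require Import all_boot all_order all_algebra.
From mathcomp Require Import all_classical all_reals all_analysis.
From mathcomp Require Import complex.
Set Implicit Arguments. Unset Strict Implicit. Unset Printing Implicit Defensive.
Import Order.TTheory GRing.Theory Num.Theory.
Import numFieldNormedType.Exports.
Local Open Scope classical_set_scope.
Local Open Scope ring_scope.

(* Point e^{2 pi i t} of the unit circle; t ranges over [0,1], so that
   Lebesgue measure on [0,1]^2 pushes forward to normalized measure sigma on T^2. *)
Definition torus_pt (R : realType) (t : R) : R[i] :=
  Complex (cos (2 * pi * t)) (sin (2 * pi * t)).

Definition sqn (R : realType) (z : R[i]) : R := complex.Re z ^+ 2 + complex.Im z ^+ 2.

(* Bivariate polynomials: p = \sum_j P_j(z) w^j, p : {poly {poly C}}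
   (outer variable w, coefficients polynomials in z). *)
Definition eval2 (R : realType) (p : {poly {poly R[i]}}) (z w : R[i]) : R[i] :=
  (map_poly (fun q : {poly R[i]} => q.[z]) p).[w].

Definition degw (R : realType) (p : {poly {poly R[i]}}) : nat := (size p).-1.
Definition degz (R : realType) (p : {poly {poly R[i]}}) : nat :=
  (\max_(j < size p) (size (nth 0%R p j)).-1)%N.

Definition stable (R : realType) (p : {poly {poly R[i]}}) : Prop :=
  forall z w : R[i], sqn z <= 1 -> sqn w <= 1 -> eval2 p z w != 0.

Definition ptilde (R : realType) (n m : nat) (p : {poly {poly R[i]}}) (z w : R[i]) : R[i] :=
  z ^+ n * w ^+ m * conjc (eval2 p (conjc z)^-1 (conjc w)^-1).

(* Functions on the torus are represented by functions C -> C -> C;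
   only their values on T^2 matter. *)
Definition lift (R : realType) (F : R[i] -> R[i] -> R[i]) (x : R * R) : R[i] :=
  F (torus_pt x.1) (torus_pt x.2).

Definition tdom (R : realType) : set (R * R) := `[0, 1] `*` `[0, 1].

Definition tmeas (R : realType) := ((@lebesgue_measure R) \x (@lebesgue_measure R))%E.
Arguments tdom R : clear implicits.
Arguments tmeas R : clear implicits.

Definition wt (R : realType) (p : {poly {poly R[i]}}) (x : R * R) : R :=
  (sqn (eval2 p (torus_pt x.1) (torus_pt x.2)))^-1.

Definition L2 (R : realType) (p : {poly {poly R[i]}}) (F : R[i] -> R[i] -> R[i]) : Prop :=
  [/\ measurable_fun (tdom R) (fun x => complex.Re (lift F x)),
      measurable_fun (tdom R) (fun x => complex.Im (lift F x)) &
      (\int[tmeas R]_(x in tdom R) (sqn (lift F x) * wt p x)%:E < +oo)%E].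

Definition nsq (R : realType) (p : {poly {poly R[i]}}) (F : R[i] -> R[i] -> R[i]) : R :=
  Rintegral (tmeas R) (tdom R) (fun x => sqn (lift F x) * wt p x).

Definition ip (R : realType) (p : {poly {poly R[i]}}) (F G : R[i] -> R[i] -> R[i]) : R[i] :=
  Complex
    (Rintegral (tmeas R) (tdom R) (fun x => complex.Re (lift F x * conjc (lift G x)) * wt p x))
    (Rintegral (tmeas R) (tdom R) (fun x => complex.Im (lift F x * conjc (lift G x)) * wt p x)).

Definition lspan (R : realType) (S : set (R[i] -> R[i] -> R[i])) : set (R[i] -> R[i] -> R[i]) :=
  [set G | exists (k : nat) (c : 'I_k -> R[i]) (g : 'I_k -> R[i] -> R[i] -> R[i]),
     (forall i, S (g i)) /\ G = (fun z w => \sum_(i < k) c i * g i z w)].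

Definition cspan (R : realType) (p : {poly {poly R[i]}}) (S : set (R[i] -> R[i] -> R[i])) :
  set (R[i] -> R[i] -> R[i]) :=
  [set F | L2 p F /\ forall eps : R, 0 < eps ->
     exists G, lspan S G /\ nsq p (fun z w => F z w - G z w) < eps].

(* Main.v *)
Require Import Defs.
From HB Require Import structures.
From mathcomp Require Import all_boot all_order all_algebra.
From mathcomp Require Import all_classical all_reals all_analysis measurable_realfun.
From mathcomp Require Import complex.
From mathcomp Require Import ring lra zify.
Import Order.TTheory GRing.Theory Num.Theory.
Import numFieldNormedType.Exports.
Local Open Scope classical_set_scope.
Local Open Scope ring_scope.
Set Implicit Arguments.
Unset Strict Implicit.
Unset Printing Implicit Defensive.

(* For |z| = 1 the quotient L(z,w;eta) / z^n is, by the Christoffel-Darboux formula, the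
   reproducing kernel of polynomials of degree < m in w for the fibre measure
   |p(z,w)|^{-2} |dw|, so the z^k a_j are biorthogonal to the z^i w^l:
     <z^i w^l, z^k a_j> = [i = n + k][l = j]   if l >= 0 and (i < n or l < m).
   Concretely, conj(z^k a_j) / |p|^2 is z^{-n-k} times
     w^{-j} - sum_{u > j} w^{u-j} p_u / p - sum_{u <= j} w^{u-j-m} conj(p_{m-u} / p),
   and the last two sums drop out because 1/p is a uniform limit of polynomials on T^2.
   This gives the orthogonality statements. Conversely, let F be in the closed span of the
   z^i w^j, orthogonal to those with i < n, and let G be a polynomial close to F. The residual
   G_N of G modulo the z^k a_j with k < N has no z-frequency in [n, n + N), and
   |G_N|^2 = <G_N, G> is small: the frequencies below n pair with G - F, and the boundedly many
   frequencies above n + N are handled by a Riemann-Lebesgue argument. *)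

(** * Complex-valued integrals over the torus *)

(** No projection in L^2 is formed: closures are handled by polynomials and an epsilon. The z^k a_j
    need not be orthogonal to each other, so G_N has no closed formula; but its orthogonality to z^k
    a_j, read through biorthogonality, says exactly that its coefficient at z^(n+k) w^j is 0. The
    obstacle is that the error might grow with N, since N m functions are subtracted. It does not: N
    exceeds the z-degree of G, and the a_j have z-degrees below a fixed d0, so at most m (n + d0)
    coefficients of G_N survive. Each is at most C |G_N|, with C depending on p alone. Hence |G_N|^2
    <= K eta |G_N|, where K is known before G and N are chosen and eta bounds the pairings of G with
    the surviving monomials. So eta can be fixed first, then G, and the Riemann-Lebesgue argument
    concerns the single polynomial G. *)

Section ComplexModulus.
Context {R : realType}.
Implicit Types x y z : R[i].

Definition cabs z : R := Num.sqrt (sqn z).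

Lemma sqn_ge0 z : 0 <= sqn z.
Proof. by rewrite addr_ge0 ?sqr_ge0. Qed.

Lemma cabs_ge0 z : 0 <= cabs z. Proof. exact: sqrtr_ge0. Qed.

Lemma sqr_cabs z : cabs z ^+ 2 = sqn z.
Proof. by rewrite sqr_sqrtr ?sqn_ge0. Qed.

Lemma cabsE z : `|z| = (cabs z)%:C%C.
Proof. exact: normc_def. Qed.

Lemma cabsD x y : cabs (x + y) <= cabs x + cabs y.
Proof. by rewrite -lecR rmorphD /= -!cabsE ler_normD. Qed.

Lemma cabsM x y : cabs (x * y) = cabs x * cabs y.
Proof. by apply: (@complexI R); rewrite rmorphM /= -!cabsE normrM. Qed.

Lemma cabsN x : cabs (- x) = cabs x.
Proof. by apply: (@complexI R); rewrite /= -!cabsE normrN. Qed.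

Lemma cabsX x k : cabs (x ^+ k) = cabs x ^+ k.
Proof. by apply: (@complexI R); rewrite rmorphXn /= -!cabsE normrX. Qed.

Lemma cabsV x : cabs x^-1 = (cabs x)^-1.
Proof. by apply: (@complexI R); rewrite fmorphV /= -!cabsE normfV. Qed.

Lemma cabs_conj x : cabs (conjc x) = cabs x.
Proof. by rewrite /cabs /sqn; case: x => a b /=; rewrite sqrrN. Qed.

Lemma conjcD x y : conjc (x + y) = conjc x + conjc y.
Proof. exact: rmorphD. Qed.

Lemma conjcB x y : conjc (x - y) = conjc x - conjc y.
Proof. exact: rmorphB. Qed.

Lemma conjcM x y : conjc (x * y) = conjc x * conjc y.
Proof. exact: rmorphM. Qed.

Lemma conjc_sum (I : Type) (r : seq I) (P : pred I) (F : I -> R[i]) :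
  conjc (\sum_(i <- r | P i) F i) = \sum_(i <- r | P i) conjc (F i).
Proof. exact: rmorph_sum. Qed.

Lemma cabs0 : cabs 0 = 0.
Proof. by rewrite /cabs /sqn /= expr0n addr0 sqrtr0. Qed.

Lemma cabs_real (r : R) : cabs r%:C%C = `|r|.
Proof. by rewrite /cabs /sqn /= expr0n addr0 sqrtr_sqr. Qed.

Lemma cabs_eq0 z : (cabs z == 0) = (z == 0).
Proof.
by rewrite -(inj_eq (@complexI R)) -cabsE normr_eq0.
Qed.

Lemma cabs_gt0 z : (0 < cabs z) = (z != 0).
Proof. by rewrite lt0r cabs_ge0 andbT cabs_eq0. Qed.

Lemma normr_Re_le z : `|complex.Re z| <= cabs z.
Proof. by rewrite /cabs -sqrtr_sqr ler_wsqrtr// lerDl sqr_ge0. Qed.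

Lemma normr_Im_le z : `|complex.Im z| <= cabs z.
Proof. by rewrite /cabs -sqrtr_sqr ler_wsqrtr// lerDr sqr_ge0. Qed.

Lemma cabs_le_ReIm z : cabs z <= `|complex.Re z| + `|complex.Im z|.
Proof.
rewrite -(@ler_pXn2r _ 2) ?nnegrE ?cabs_ge0 ?addr_ge0// sqr_cabs sqrrD.
by rewrite !real_normK ?num_real// /sqn -addrA lerD2l lerDr mulrn_wge0 ?mulr_ge0.
Qed.

Lemma sqn_gt0 z : (0 < sqn z) = (z != 0).
Proof. by rewrite -sqr_cabs exprn_even_gt0 //= cabs_eq0. Qed.

Lemma mul_conjc z : z * conjc z = (sqn z)%:C%C.
Proof. by rewrite -sqr_normc cabsE -rmorphXn /= sqr_cabs. Qed.

Lemma sqn_torus_pt (t : R) : sqn (torus_pt t) = 1.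
Proof. by rewrite /sqn /= cos2Dsin2. Qed.

Lemma cabs_sqn1 z : sqn z = 1 -> cabs z = 1.
Proof. by rewrite /cabs => ->; rewrite sqrtr1. Qed.

Lemma cabs_sum (I : Type) (r : seq I) (P : pred I) (F : I -> R[i]) :
  cabs (\sum_(i <- r | P i) F i) <= \sum_(i <- r | P i) cabs (F i).
Proof.
elim/big_rec2: _ => [|i x y _ h]; first by rewrite cabs0.
by apply: le_trans (cabsD _ _) _; rewrite lerD2l.
Qed.

End ComplexModulus.

Section ComplexIntegral.
Context {R : realType}.
Notation TT := (measurableTypeR R * measurableTypeR R)%type.
Notation mu := (tmeas R).
Notation D := (tdom R : set TT).
Implicit Types f g : TT -> R[i].

Definition cmeas f : Prop :=
  measurable_fun D (fun x => complex.Re (f x)) /\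
  measurable_fun D (fun x => complex.Im (f x)).

Definition cintegrable f : Prop :=
  mu.-integrable D (EFin \o (fun x => complex.Re (f x))) /\
  mu.-integrable D (EFin \o (fun x => complex.Im (f x))).

(** Componentwise, in the same shape as [ip], so that [ipE] is a comparison of real integrals. *)
Definition cint f : R[i] :=
  Complex (Rintegral mu D (fun x => complex.Re (f x)))
          (Rintegral mu D (fun x => complex.Im (f x))).

Lemma measurable_tdom : measurable D.
Proof. by apply: measurableX; exact: measurable_itv. Qed.

Lemma tmeas_tdom : mu D = 1%E.
Proof.
rewrite /tmeas /tdom product_measure1E; try exact: measurable_itv.
by rewrite /= lebesgue_measure_itv /= lte01 oppr0 adde0 mule1.
Qed.

Lemma cmeas_cst (c : R[i]) : cmeas (fun=> c).
Proof. by split; exact: measurable_cst. Qed.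

Lemma cmeasD f g : cmeas f -> cmeas g -> cmeas (fun x => f x + g x).
Proof.
move=> [f1 f2] [g1 g2]; split.
  by under eq_fun do rewrite raddfD /=; exact: measurable_funD.
by under eq_fun do rewrite raddfD /=; exact: measurable_funD.
Qed.

Lemma cmeasM f g : cmeas f -> cmeas g -> cmeas (fun x => f x * g x).
Proof.
move=> [f1 f2] [g1 g2]; split.
  have -> : (fun x => complex.Re (f x * g x)) =
    (fun x => complex.Re (f x) * complex.Re (g x) - complex.Im (f x) * complex.Im (g x)).
    by apply/funext => x; case: (f x) (g x) => [? ?] [? ?].
  by apply: measurable_funB; apply: measurable_funM.
have -> : (fun x => complex.Im (f x * g x)) =
  (fun x => complex.Re (f x) * complex.Im (g x) + complex.Im (f x) * complex.Re (g x)).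
  by apply/funext => x; case: (f x) (g x) => [? ?] [? ?].
by apply: measurable_funD; apply: measurable_funM.
Qed.

Lemma cmeas_conj f : cmeas f -> cmeas (fun x => conjc (f x)).
Proof.
move=> [f1 f2]; split.
  have -> : (fun x => complex.Re (conjc (f x))) = (fun x => complex.Re (f x)).
    by apply/funext => x; case: (f x).
  by [].
have -> : (fun x => complex.Im (conjc (f x))) = (fun x => - complex.Im (f x)).
  by apply/funext => x; case: (f x).
exact: measurable_funN.
Qed.

Lemma cmeas_sqn f : cmeas f -> measurable_fun D (fun x => sqn (f x)).
Proof. by move=> [f1 f2]; apply: measurable_funD; apply: measurable_funX. Qed.

Lemma cmeasR (h : TT -> R) : measurable_fun D h -> cmeas (fun x => (h x)%:C%C).
Proof. by move=> mh; split => //=; exact: measurable_cst. Qed.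

Lemma measurable_invr (h : TT -> R) : (forall x, 0 <= h x) ->
  measurable_fun D h -> measurable_fun D (fun x => (h x)^-1).
Proof.
move=> h0 mh.
(* On nonnegative reals the inverse is the power with exponent -1, also at 0, where both are 0 by
   convention; powers are measurable. *)
under eq_fun do rewrite -powR_inv1 //.
apply: (@measurableT_comp _ _ _ TT R R (fun t : R => powR t (-1)) _ h) => //; exact: measurable_powR.
Qed.

Lemma integrable_dominated (g h : TT -> R) : measurable_fun D g ->
  mu.-integrable D (EFin \o h) -> (forall x, D x -> `|g x| <= h x) ->
  mu.-integrable D (EFin \o g).
Proof.
move=> mg ih gh; apply: (le_integrable measurable_tdom _ _ ih).
  exact/measurable_EFinP.
by move=> x Dx /=; rewrite lee_fin (le_trans (gh _ Dx))// ler_norm.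
Qed.

Lemma integrable_tdom_cst (r : R) : mu.-integrable D (EFin \o (fun=> r)).
Proof.
apply: (@measurable_bounded_integrable _ TT R mu) => //.
- exact: measurable_tdom.
- by rewrite [ltLHS]tmeas_tdom ltry.
- exists `|r|; split; first exact: num_real.
  by move=> M rM x _ /=; apply: ltW.
Qed.

Lemma cintegrable_dominated f (h : TT -> R) : cmeas f ->
  mu.-integrable D (EFin \o h) -> (forall x, D x -> cabs (f x) <= h x) ->
  cintegrable f.
Proof.
move=> [m1 m2] ih fh; split.
  by apply: (integrable_dominated m1 ih) => x Dx; apply: le_trans (normr_Re_le _) (fh _ Dx).
by apply: (integrable_dominated m2 ih) => x Dx; apply: le_trans (normr_Im_le _) (fh _ Dx).
Qed.

Lemma bounded_cintegrable f (M : R) : cmeas f ->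
  (forall x, D x -> cabs (f x) <= M) -> cintegrable f.
Proof. by move=> mf; apply: cintegrable_dominated (integrable_tdom_cst M). Qed.

Lemma eq_cint f g : (forall x, D x -> f x = g x) -> cint f = cint g.
Proof.
move=> fg; congr Complex; apply: eq_Rintegral => x; rewrite inE => Dx /=;
  by rewrite fg.
Qed.

Lemma cintegrableD f g : cintegrable f -> cintegrable g ->
  cintegrable (fun x => f x + g x).
Proof.
move=> [f1 f2] [g1 g2]; split.
- have -> : EFin \o (fun x => complex.Re (f x + g x)) =
    ((EFin \o (fun x => complex.Re (f x))) \+ (EFin \o (fun x => complex.Re (g x))))%E.
    by apply/funext => x /=; rewrite raddfD.
  by apply: integrableD => //; exact: measurable_tdom.
- have -> : EFin \o (fun x => complex.Im (f x + g x)) =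
    ((EFin \o (fun x => complex.Im (f x))) \+ (EFin \o (fun x => complex.Im (g x))))%E.
    by apply/funext => x /=; rewrite raddfD.
  by apply: integrableD => //; exact: measurable_tdom.
Qed.

Lemma cintD f g : cintegrable f -> cintegrable g ->
  cint (fun x => f x + g x) = cint f + cint g.
Proof.
move=> [f1 f2] [g1 g2]; rewrite /cint.
under eq_Rintegral do rewrite raddfD /=.
under [X in Complex _ X]eq_Rintegral do rewrite raddfD /=.
by rewrite !RintegralD //; exact: measurable_tdom.
Qed.

Lemma cintegrableZ (c : R[i]) f : cintegrable f -> cintegrable (fun x => c * f x).
Proof.
case: c => a b [f1 f2]; split.
- have -> : EFin \o (fun x => complex.Re (Complex a b * f x)) =
    (fun x => a%:E * (EFin \o (fun x => complex.Re (f x))) x -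
             b%:E * (EFin \o (fun x => complex.Im (f x))) x)%E.
    by apply/funext => x /=; case: (f x).
  by apply: integrableB; [exact: measurable_tdom| |];
     apply: integrableZl => //; exact: measurable_tdom.
- have -> : EFin \o (fun x => complex.Im (Complex a b * f x)) =
    (fun x => a%:E * (EFin \o (fun x => complex.Im (f x))) x +
             b%:E * (EFin \o (fun x => complex.Re (f x))) x)%E.
    by apply/funext => x /=; case: (f x).
  by apply: integrableD; [exact: measurable_tdom| |];
     apply: integrableZl => //; exact: measurable_tdom.
Qed.

Lemma integrableZ_real (r : R) (h : TT -> R) : mu.-integrable D (EFin \o h) ->
  mu.-integrable D (EFin \o (fun x => r * h x)).
Proof.
move=> ih.
have -> : EFin \o (fun x => r * h x) = (fun x => r%:E * (EFin \o h) x)%E by [].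
by apply: integrableZl => //; exact: measurable_tdom.
Qed.

Lemma cintZ (c : R[i]) f : cintegrable f -> cint (fun x => c * f x) = c * cint f.
Proof.
case: c => a b [f1 f2]; rewrite /cint.
have -> : (fun x => complex.Re (Complex a b * f x)) =
    (fun x => a * complex.Re (f x) - b * complex.Im (f x)).
    by apply/funext => x /=; case: (f x).
have -> : (fun x => complex.Im (Complex a b * f x)) =
    (fun x => a * complex.Im (f x) + b * complex.Re (f x)).
    by apply/funext => x /=; case: (f x).
rewrite RintegralB; [|exact: measurable_tdom|exact: integrableZ_real..].
rewrite RintegralD; [|exact: measurable_tdom|exact: integrableZ_real..].
by rewrite !RintegralZl //; exact: measurable_tdom.
Qed.

Lemma cint_conj f : cintegrable f -> cint (fun x => conjc (f x)) = conjc (cint f).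
Proof.
move=> [f1 f2]; rewrite /cint /=; congr Complex.
  by apply: eq_Rintegral => x _; case: (f x).
rewrite -mulN1r -RintegralZl //; last exact: measurable_tdom.
by apply: eq_Rintegral => x _; case: (f x) => ? ? /=; rewrite mulN1r.
Qed.

Lemma cintegrable_sum (I : Type) (r : seq I) (P : pred I) (F : I -> TT -> R[i]) :
  (forall i, P i -> cintegrable (F i)) ->
  cintegrable (fun x => \sum_(i <- r | P i) F i x).
Proof.
move=> iF; elim: r => [|i r IH].
  under eq_fun do rewrite big_nil.
  by apply: (@bounded_cintegrable _ 0); [exact: cmeas_cst | move=> x _; rewrite cabs0].
under eq_fun do rewrite big_cons.
have [Pi|_] := boolP (P i); last exact: IH.
by apply: cintegrableD => //; exact: iF.
Qed.

Lemma cint_sum (I : Type) (r : seq I) (P : pred I) (F : I -> TT -> R[i]) :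
  (forall i, P i -> cintegrable (F i)) ->
  cint (fun x => \sum_(i <- r | P i) F i x) = \sum_(i <- r | P i) cint (F i).
Proof.
move=> iF; elim: r => [|i r IH].
  rewrite big_nil; under eq_fun do rewrite big_nil.
  by rewrite /cint /= Rintegral_cst ?mul0r//; exact: measurable_tdom.
rewrite big_cons; under eq_fun do rewrite big_cons.
have [Pi|_] := boolP (P i); last exact: IH.
by rewrite cintD ?IH //; [exact: iF | exact: cintegrable_sum].
Qed.

(** Real and imaginary parts are each bounded by [M], whence the factor 2. It is not sharp, but it
    is harmless where [M] can be made arbitrarily small. *)
Lemma cabs_cint_le f (M : R) : cintegrable f ->
  (forall x, D x -> cabs (f x) <= M) -> cabs (cint f) <= M *+ 2.
Proof.
move=> [f1 f2] fM; apply: le_trans (cabs_le_ReIm _) _; rewrite mulr2n.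
have bnd (h : TT -> R) : mu.-integrable D (EFin \o h) ->
    (forall x, D x -> `|h x| <= M) -> `|Rintegral mu D h| <= M.
  move=> ih hM; apply: le_trans (le_normr_Rintegral measurable_tdom ih) _.
  have -> : M = Rintegral mu D (fun=> M).
    rewrite Rintegral_cst; last exact: measurable_tdom.
    by rewrite [X in fine X]tmeas_tdom mulr1.
  apply: le_Rintegral => //; [exact: measurable_tdom| |exact: integrable_tdom_cst].
  exact: (integrable_norm ih).
by apply: lerD; apply: bnd => // x Dx;
  [apply: le_trans (normr_Re_le _) (fM _ Dx)|apply: le_trans (normr_Im_le _) (fM _ Dx)].
Qed.

End ComplexIntegral.

(** * Orthogonality of the characters of the torus *)

Section TorusMonomials.
Context {R : realType}.
Notation TT := (measurableTypeR R * measurableTypeR R)%type.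
Notation mu := (tmeas R).
Notation D := (tdom R : set TT).
Implicit Types (t : R).

Lemma torus_ptD (s t : R) : torus_pt (s + t) = torus_pt s * torus_pt t.
Proof.
rewrite /torus_pt mulrDr cosD sinD; congr Complex.
by rewrite addrC.
Qed.

Lemma torus_pt0 : torus_pt (0 : R) = 1.
Proof. by rewrite /torus_pt mulr0 cos0 sin0. Qed.

Lemma torus_pt_neq0 t : torus_pt t != 0.
Proof. by rewrite -sqn_gt0 sqn_torus_pt ltr01. Qed.

Lemma torus_ptX t (k : nat) : torus_pt t ^+ k = torus_pt (k%:R * t).
Proof.
elim: k => [|k IH]; first by rewrite expr0 mul0r torus_pt0.
by rewrite exprS IH -torus_ptD -{1}(mul1r t) -mulrDl -natr1 addrC.
Qed.

Lemma torus_ptV t : (torus_pt t)^-1 = torus_pt (- t).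
Proof.
by apply: (mulfI (torus_pt_neq0 t)); rewrite divff ?torus_pt_neq0 // -torus_ptD subrr torus_pt0.
Qed.

Lemma torus_ptXz t (k : int) : torus_pt t ^ k = torus_pt (k%:~R * t).
Proof.
case: k => k; first by rewrite -exprnP torus_ptX.
by rewrite NegzE -exprnN -exprVn torus_ptV torus_ptX mulrNz mulrN mulNr.
Qed.

Lemma torus_pt_conj t : conjc (torus_pt t) = (torus_pt t)^-1.
Proof. by rewrite torus_ptV /torus_pt /= mulrN cosN sinN. Qed.

(** Integer exponents make this family closed under products and conjugation. *)
Definition tmono (a b : int) (x : TT) : R[i] := torus_pt x.1 ^ a * torus_pt x.2 ^ b.

Lemma tmonoE a b x : tmono a b x = torus_pt (a%:~R * x.1 + b%:~R * x.2).
Proof. by rewrite /tmono !torus_ptXz torus_ptD. Qed.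

Lemma cabs_torus_pt t : cabs (torus_pt t) = 1.
Proof. exact: cabs_sqn1 (sqn_torus_pt t). Qed.

Lemma cabs_tmono a b x : cabs (tmono a b x) = 1.
Proof. by rewrite tmonoE cabs_torus_pt. Qed.

Lemma tmonoD a b c d x : tmono a b x * tmono c d x = tmono (a + c) (b + d) x.
Proof. by rewrite /tmono !expfzDr ?torus_pt_neq0 // mulrACA. Qed.

Lemma tmono_conj a b x : conjc (tmono a b x) = tmono (- a) (- b) x.
Proof.
rewrite !tmonoE; set s := (_ + _ : R); set s' := (_ + _ : R).
have -> : s' = - s by rewrite /s /s' opprD !mulrNz !mulNr.
by rewrite torus_pt_conj torus_ptV.
Qed.

Lemma measurable_fst_tdom : measurable_fun D (fun x : TT => x.1).
Proof. by apply: measurable_funTS; exact: measurable_fst. Qed.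

Lemma measurable_snd_tdom : measurable_fun D (fun x : TT => x.2).
Proof. by apply: measurable_funTS; exact: measurable_snd. Qed.

Lemma cmeas_torus_pt (h : TT -> R) : measurable_fun D h ->
  cmeas (fun x => torus_pt (h x)).
Proof.
move=> mh; split => /=.
  apply: (@measurableT_comp _ _ _ TT R R (fun t : R => cos (2 * pi * t)) _ h) => //.
  apply: continuous_measurable_fun => t; apply: continuous_comp.
    by apply: cvgM; [exact: cvg_cst | exact: cvg_id].
  exact: continuous_cos.
apply: (@measurableT_comp _ _ _ TT R R (fun t : R => sin (2 * pi * t)) _ h) => //.
apply: continuous_measurable_fun => t; apply: continuous_comp.
  by apply: cvgM; [exact: cvg_cst | exact: cvg_id].
exact: continuous_sin.
Qed.

Lemma cmeas_tmono a b : cmeas (tmono a b).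
Proof.
have -> : tmono a b = (fun x => torus_pt (a%:~R * x.1 + b%:~R * x.2)).
  by apply/funext => x; rewrite tmonoE.
apply: cmeas_torus_pt; apply: measurable_funD; apply: measurable_funM;
  do ?exact: measurable_cst; [exact: measurable_fst_tdom|exact: measurable_snd_tdom].
Qed.

Lemma cintegrable_tmono a b : cintegrable (tmono a b).
Proof.
apply: (@bounded_cintegrable _ _ 1); first exact: cmeas_tmono.
by move=> x _; rewrite cabs_tmono.
Qed.

(** The antiderivative sin(A + B s) / B takes the same value at both endpoints. [A] will carry the
    contribution of the coordinate held fixed. *)
Lemma integral_cos_affine (A B : R) : B != 0 -> sin (A + B) = sin A ->
  (\int[lebesgue_measure]_(s in `[0%R, 1%R]) (cos (A + B * s))%:E = 0)%E.
Proof.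
move=> B0 AB.
have dF (s : R) : is_derive s 1 (fun s => sin (A + B * s) / B) (cos (A + B * s)).
  have H : is_derive s (1:R) (fun s : R => A + B * s) B.
    have := @is_deriveD _ _ _ _ _ _ _ _ _ (is_derive_cst A s (1:R))
      (is_deriveM (is_derive_cst B s (1:R)) (is_derive_id s (1:R))).
    move=> /(is_derive_eq); apply.
    by rewrite scaler0 addr0 add0r /GRing.scale /= mulr1.
  have := is_deriveM (@is_derive1_comp _ sin (fun s : R => A + B * s) _ _ _ (is_derive_sin (A + B * s)) H)
    (is_derive_cst (B^-1) s (1:R)).
  move=> /(is_derive_eq); apply.
  by rewrite scaler0 add0r /GRing.scale /=; field.
rewrite (@continuous_FTC2 _ _ (fun s => sin (A + B * s) / B)) //.
- by rewrite mulr1 mulr0 addr0 AB -EFinB subrr.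
- apply: continuous_subspaceT => s; apply: continuous_comp.
    by apply: cvgD; [exact: cvg_cst | apply: cvgM; [exact: cvg_cst | exact: cvg_id]].
  exact: continuous_cos.
- split.
  + by move=> s _; have [] := dF s.
  + apply: cvg_at_right_filter.
    by have [/derivable1_diffP/differentiable_continuous] := dF 0.
  + apply: cvg_at_left_filter.
    by have [/derivable1_diffP/differentiable_continuous] := dF 1.
- by move=> s _; rewrite derive1E; have [_ ->] := dF s.
Qed.

Lemma integral_sin_affine (A B : R) : B != 0 -> cos (A + B) = cos A ->
  (\int[lebesgue_measure]_(s in `[0%R, 1%R]) (sin (A + B * s))%:E = 0)%E.
Proof.
move=> B0 AB; rewrite -(@integral_cos_affine (A - pi / 2) B B0).
  apply: eq_integral => s _; congr EFin.
  have -> : A + B * s = (A - pi / 2 + B * s) + pi / 2 by ring.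
  by rewrite sinDpihalf.
have e x : sin (x - pi / 2) = - cos x.
  by rewrite -[in RHS](subrK (pi / 2) x) cosDpihalf opprK.
by rewrite -addrAC !e AB.
Qed.

Lemma Rintegral_tdom_eq0_snd (f : TT -> R) : mu.-integrable D (EFin \o f) ->
  (forall t, (\int[lebesgue_measure]_(s in `[0%R, 1%R]) (f (t, s))%:E = 0)%E) ->
  Rintegral mu D f = 0.
Proof.
move=> intf f0; rewrite /Rintegral integral_mkcond.
have intf' : mu.-integrable setT ((fun x => (f x)%:E) \_ D).
  by have /(integrable_mkcond _ measurable_tdom) := intf.
have E : (\int[mu]_x ((fun x => (f x)%:E) \_ D) x = 0)%E.
  rewrite -(integral12_prod_meas1 intf') integral0_eq // => t _.
  rewrite /fubini_F -[RHS](f0 t) [in RHS]integral_mkcond.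
  (* Fubini is applied to the extension of [f] by zero, so slices at [t] outside [0,1] have to be
     treated too; they vanish identically. *)
  have [t01|t01] := boolP (t \in `[0%R, 1%R]).
    apply: eq_integral => s _; rewrite !patchE.
    have -> // : ((t, s) \in D) = (s \in (`[0, 1]%classic : set R)).
    apply/idP/idP; rewrite !inE; first by case.
    by move=> h; split => //=; rewrite -inE.
  rewrite -integral_mkcond f0 integral0_eq // => s _.
  by rewrite patchE memNset // => -[/= h _]; move: t01; rewrite h.
by rewrite E.
Qed.

Lemma Rintegral_tdom_eq0_fst (f : TT -> R) : mu.-integrable D (EFin \o f) ->
  (forall s, (\int[lebesgue_measure]_(t in `[0%R, 1%R]) (f (t, s))%:E = 0)%E) ->
  Rintegral mu D f = 0.
Proof.
move=> intf f0; rewrite /Rintegral integral_mkcond.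
have intf' : mu.-integrable setT ((fun x => (f x)%:E) \_ D).
  by have /(integrable_mkcond _ measurable_tdom) := intf.
have E : (\int[mu]_x ((fun x => (f x)%:E) \_ D) x = 0)%E.
  rewrite -(integral21_prod_meas1 intf') integral0_eq // => s _.
  rewrite /fubini_G -[RHS](f0 s) [in RHS]integral_mkcond.
  have [s01|s01] := boolP (s \in `[0%R, 1%R]).
    apply: eq_integral => t _; rewrite !patchE.
    have -> // : ((t, s) \in D) = (t \in (`[0, 1]%classic : set R)).
    apply/idP/idP; rewrite !inE; first by case.
    by move=> h; split => //=; rewrite -inE.
  rewrite -integral_mkcond f0 integral0_eq // => t _.
  by rewrite patchE memNset // => -[/= _ h]; move: s01; rewrite h.
by rewrite E.
Qed.

Lemma cos_sin_periodz (x : R) (k : int) :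
  cos (x + 2 * pi * k%:~R) = cos x /\ sin (x + 2 * pi * k%:~R) = sin x.
Proof.
have e : torus_pt (k%:~R : R) = 1.
  have h1 : torus_pt (1 : R) = 1 by rewrite /torus_pt mulr1 mulr_natl cos2pi sin2pi.
  by rewrite -[_%:~R]mulr1 -torus_ptXz h1 exp1rz.
case: e => c s; rewrite cosD sinD c s.
by rewrite !mulr1 !mulr0 subr0 addr0.
Qed.

Lemma cint_tmono a b : cint (tmono a b) = ((a == 0) && (b == 0))%:R.
Proof.
case: (boolP ((a == 0) && (b == 0))) => [/andP[/eqP -> /eqP ->]|ab].
  rewrite (@eq_cint _ _ (fun=> 1)).
    by rewrite /cint /= !Rintegral_cst ?mul0r ?mul1r; [rewrite [fine _](congr1 fine tmeas_tdom)|exact: measurable_tdom..].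
  by move=> x _; rewrite /tmono !expr0z mulr1.
have [i1 i2] := cintegrable_tmono a b.
have e1 : (fun x => complex.Re (tmono a b x)) =
    fun x => cos (2 * pi * (a%:~R * x.1 + b%:~R * x.2)).
  by apply/funext => x; rewrite tmonoE.
have e2 : (fun x => complex.Im (tmono a b x)) =
    fun x => sin (2 * pi * (a%:~R * x.1 + b%:~R * x.2)).
  by apply/funext => x; rewrite tmonoE.
have npi (k : int) : k != 0 -> 2 * pi * k%:~R != 0 :> R.
  move=> k0; apply: mulf_neq0; last by rewrite intr_eq0.
  by rewrite mulf_neq0 ?pnatr_eq0 // gt_eqF // pi_gt0.
rewrite /cint e1 e2; rewrite e1 in i1; rewrite e2 in i2.
(* The inner integration runs over a coordinate whose frequency is nonzero. *)
move: ab; rewrite negb_and => /orP[a0|b0].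
  rewrite !Rintegral_tdom_eq0_fst // => s /=.
  - have := @integral_sin_affine (2 * pi * (b%:~R * s)) _ (npi _ a0) (cos_sin_periodz _ _).1.
    by move=> <-; apply: eq_integral => t _; congr (EFin (sin _)); ring.
  - have := @integral_cos_affine (2 * pi * (b%:~R * s)) _ (npi _ a0) (cos_sin_periodz _ _).2.
    by move=> <-; apply: eq_integral => t _; congr (EFin (cos _)); ring.
rewrite !Rintegral_tdom_eq0_snd // => t /=.
- have := @integral_sin_affine (2 * pi * (a%:~R * t)) _ (npi _ b0) (cos_sin_periodz _ _).1.
  by move=> <-; apply: eq_integral => s _; congr (EFin (sin _)); ring.
- have := @integral_cos_affine (2 * pi * (a%:~R * t)) _ (npi _ b0) (cos_sin_periodz _ _).2.
  by move=> <-; apply: eq_integral => s _; congr (EFin (cos _)); ring.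
Qed.

End TorusMonomials.

(** * Uniform approximation of 1/p by polynomials *)

Section Eval2.
Context {R : realType}.
Implicit Types (p q : {poly {poly R[i]}}) (z w : R[i]).

Lemma eval2E p z w : eval2 p z w = (map_poly (horner_eval z) p).[w].
Proof. by []. Qed.

Lemma eval2D p q z w : eval2 (p + q) z w = eval2 p z w + eval2 q z w.
Proof. by rewrite !eval2E rmorphD hornerD. Qed.

Lemma eval2N p z w : eval2 (- p) z w = - eval2 p z w.
Proof. by rewrite !eval2E rmorphN hornerN. Qed.

Lemma eval2M p q z w : eval2 (p * q) z w = eval2 p z w * eval2 q z w.
Proof. by rewrite !eval2E rmorphM hornerM. Qed.

Lemma eval2C (c : {poly R[i]}) z w : eval2 c%:P z w = c.[z].
Proof. by rewrite !eval2E map_polyC hornerC. Qed.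

Lemma eval2X z w : eval2 'X z w = w.
Proof. by rewrite !eval2E map_polyX hornerX. Qed.

Lemma eval2Xn k z w : eval2 'X^k z w = w ^+ k.
Proof. by rewrite !eval2E map_polyXn hornerXn. Qed.

Lemma eval2_sum (I : Type) (r : seq I) (P : pred I) (F : I -> {poly {poly R[i]}}) z w :
  eval2 (\sum_(i <- r | P i) F i) z w = \sum_(i <- r | P i) eval2 (F i) z w.
Proof. by rewrite !eval2E rmorph_sum horner_sum. Qed.

Lemma eval2_coef p (M : nat) z w : (size p <= M)%N ->
  eval2 p z w = \sum_(j < M) (p`_j).[z] * w ^+ j.
Proof.
move=> pM; rewrite eval2E (@horner_coef_wide _ M); last first.
  exact: leq_trans (size_poly _ _) pM.
by apply: eq_bigr => j _; rewrite coef_map.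
Qed.

Lemma eval2_expand p (M N : nat) z w : (size p <= M)%N ->
  (forall j, (j < M)%N -> (size (p`_j)%R <= N)%N) ->
  eval2 p z w = \sum_(j < M) \sum_(i < N) p`_j`_i * (z ^+ i * w ^+ j).
Proof.
move=> pM pN; rewrite (eval2_coef _ _ pM); apply: eq_bigr => j _.
rewrite (horner_coef_wide _ (pN _ (ltn_ord j))) mulr_suml.
by apply: eq_bigr => i _; rewrite mulrA.
Qed.

(** A crude bound, the sum of all inner sizes. It is applied to a single polynomial ([k] = 1) and to
    the family of all [cdpoly j] ([k] = m), where uniformity in j is the point. *)
Lemma coef_sizes_bounded (k : nat) (F : nat -> {poly {poly R[i]}}) :
  exists N, forall i j, (i < k)%N -> (size ((F i)`_j)%R <= N)%N.
Proof.
exists (\sum_(i < k) \sum_(j < size (F i)) size ((F i)`_j)%R)%N => i j ik.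
have [sj|sj] := leqP (size (F i)) j; first by rewrite (nth_default _ sj) size_poly0.
rewrite (bigD1 (Ordinal ik)) //=; apply: leq_trans (leq_addr _ _).
by rewrite (bigD1 (Ordinal sj)) //= leq_addr.
Qed.

(** Any property preserved by the ring operations passes from the two substituted coordinates to all
    polynomials in them. Boundedness, measurability, continuity, approximability and the Lipschitz
    estimate are all obtained this way. *)
Lemma eval2_ind (X : Type) (P : (X -> R[i]) -> Prop) (Z W : X -> R[i]) :
  (forall c, P (fun=> c)) ->
  (forall f g, P f -> P g -> P (fun x => f x + g x)) ->
  (forall f g, P f -> P g -> P (fun x => f x * g x)) ->
  P Z -> P W -> forall p, P (fun x => eval2 p (Z x) (W x)).
Proof.
move=> Pc PD PM PZ PW; elim/poly_ind => [|p c IH].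
  have -> : (fun x => eval2 0 (Z x) (W x)) = fun=> 0 by apply/funext => x; rewrite eval2E rmorph0 horner0.
  exact: Pc.
have -> : (fun x => eval2 (p * 'X + c%:P) (Z x) (W x)) =
    fun x => eval2 p (Z x) (W x) * W x + c.[Z x].
  by apply/funext => x; rewrite eval2D eval2M eval2X eval2C.
apply: (PD); first exact: PM.
elim/poly_ind: c {p IH} => [|c a IH].
  have -> : (fun x => (0 : {poly R[i]}).[Z x]) = fun=> 0 by apply/funext => x; rewrite horner0.
  exact: Pc.
have -> : (fun x => (c * 'X + a%:P).[Z x]) = fun x => c.[Z x] * Z x + a.
  by apply/funext => x; rewrite hornerMXaddC.
by apply: PD => //; apply: PM.
Qed.

End Eval2.

Section UniformApproximation.
Context {R : realType}.
Notation TT := (measurableTypeR R * measurableTypeR R)%type.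
Notation D := (tdom R : set TT).
Implicit Types (p q : {poly {poly R[i]}}) (f g u v : TT -> R[i]).

Definition teval p (x : TT) : R[i] := eval2 p (torus_pt x.1) (torus_pt x.2).

(** The bidisk algebra restricted to the torus: the uniform closure of the polynomials in z and w,
    without negative powers. *)
Definition approx f : Prop := forall eps : R, 0 < eps ->
  exists q, forall x, D x -> cabs (f x - teval q x) <= eps.

Definition tbounded f : Prop := exists2 M : R, 0 < M & forall x, D x -> cabs (f x) <= M.

Lemma tbounded_cst c : tbounded (fun=> c).
Proof.
by exists (cabs c + 1) => [|x _]; rewrite ?ltr_wpDl ?cabs_ge0 // lerDl.
Qed.

Lemma tboundedD f g : tbounded f -> tbounded g -> tbounded (fun x => f x + g x).
Proof.
move=> [M M0 fM] [N N0 gN]; exists (M + N) => [|x Dx]; first by rewrite addr_gt0.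
by apply: le_trans (cabsD _ _) _; rewrite lerD ?fM ?gN.
Qed.

Lemma tboundedM f g : tbounded f -> tbounded g -> tbounded (fun x => f x * g x).
Proof.
move=> [M M0 fM] [N N0 gN]; exists (M * N) => [|x Dx]; first by rewrite mulr_gt0.
by rewrite cabsM ler_pM ?cabs_ge0 ?fM ?gN.
Qed.

Lemma tbounded_conj f : tbounded f -> tbounded (fun x => conjc (f x)).
Proof. by move=> [M M0 fM]; exists M => // x Dx; rewrite cabs_conj fM. Qed.

Lemma tbounded_unimodular f : (forall x, cabs (f x) = 1) -> tbounded f.
Proof. by move=> f1; exists 1 => // x _; rewrite f1. Qed.

Lemma tbounded_teval q : tbounded (teval q).
Proof.
apply: (eval2_ind (P := tbounded)); [exact: tbounded_cst|exact: tboundedD|exact: tboundedM|..].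
  by apply: tbounded_unimodular => x; exact: cabs_torus_pt.
by apply: tbounded_unimodular => x; exact: cabs_torus_pt.
Qed.

Lemma cmeas_teval q : cmeas (teval q).
Proof.
apply: (eval2_ind (P := @cmeas R)); [exact: cmeas_cst|exact: cmeasD|exact: cmeasM|..].
  exact: cmeas_torus_pt measurable_fst_tdom.
exact: cmeas_torus_pt measurable_snd_tdom.
Qed.

Lemma approx_bounded f : approx f -> tbounded f.
Proof.
move=> /(_ 1 ltr01)[q fq]; have [M M0 qM] := tbounded_teval q.
exists (1 + M) => [|x Dx]; first by rewrite addr_gt0.
rewrite -(subrK (teval q x) (f x)); apply: le_trans (cabsD _ _) _.
by rewrite lerD ?fq ?qM.
Qed.

Lemma approx_teval q : approx (teval q).
Proof. by move=> e e0; exists q => x _; rewrite subrr cabs0 ltW. Qed.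

Lemma approx_cst c : approx (fun=> c).
Proof.
have -> : (fun=> c) = teval c%:P%:P; last exact: approx_teval.
by apply/funext => x; rewrite /teval eval2C hornerC.
Qed.

Lemma approx_fst : approx (fun x => torus_pt x.1).
Proof.
have -> : (fun x : TT => torus_pt x.1) = teval 'X%:P; last exact: approx_teval.
by apply/funext => x; rewrite /teval eval2C hornerX.
Qed.

Lemma approx_snd : approx (fun x => torus_pt x.2).
Proof.
have -> : (fun x : TT => torus_pt x.2) = teval 'X; last exact: approx_teval.
by apply/funext => x; rewrite /teval eval2X.
Qed.

Lemma approxD f g : approx f -> approx g -> approx (fun x => f x + g x).
Proof.
move=> af ag e e0; have e20 : 0 < e / 2 by rewrite divr_gt0.
have [q fq] := af _ e20; have [r gr] := ag _ e20.
exists (q + r) => x Dx; rewrite /teval eval2D opprD addrACA [leRHS](splitr e).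
by apply: le_trans (cabsD _ _) _; rewrite lerD ?fq ?gr.
Qed.

Lemma approxM f g : approx f -> approx g -> approx (fun x => f x * g x).
Proof.
move=> af ag e e0; have [N N0 gN] := approx_bounded ag.
have [q fq] := af (e / 2 / N) (divr_gt0 (divr_gt0 e0 (@ltr0n R 2)) N0).
(* [r] is chosen after [q], because its tolerance is divided by the bound [M] of [q]. *)
have [M M0 qM] := tbounded_teval q.
have [r gr] := ag (e / 2 / M) (divr_gt0 (divr_gt0 e0 (@ltr0n R 2)) M0).
exists (q * r) => x Dx; rewrite /teval eval2M -/(teval q x) -/(teval r x).
have -> : f x * g x - teval q x * teval r x =
  (f x - teval q x) * g x + teval q x * (g x - teval r x) by ring.
apply: le_trans (cabsD _ _) _; rewrite !cabsM [leRHS](splitr e); apply: lerD.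
  rewrite -[leRHS](@divfK _ N) ?gt_eqF //.
  by rewrite ler_pM ?cabs_ge0 ?fq ?gN.
rewrite -[leRHS](@divfK _ M) ?gt_eqF // [leRHS]mulrC.
by rewrite ler_pM ?cabs_ge0 ?gr ?qM.
Qed.

Lemma approx_uniform_limit f : (forall eps : R, 0 < eps -> exists2 g, approx g &
  forall x, D x -> cabs (f x - g x) <= eps) -> approx f.
Proof.
move=> H e e0; have e20 : 0 < e / 2 by rewrite divr_gt0.
have [g ag fg] := H _ e20; have [q gq] := ag _ e20.
exists q => x Dx; have -> : f x - teval q x = (f x - g x) + (g x - teval q x) by ring.
by rewrite [leRHS](splitr e); apply: le_trans (cabsD _ _) _; rewrite lerD ?fg ?gq.
Qed.

Lemma approx_eq f g : (forall x, D x -> f x = g x) -> approx f -> approx g.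
Proof. by move=> fg af e /af[q fq]; exists q => x Dx; rewrite -fg ?fq. Qed.

(* 1/v = sum_k (u - v)^k / u^(k+1), which converges uniformly when |u - v| <= |u| / 2. *)
Lemma approx_inv_near u v (c : R) : 0 < c ->
  (forall x, D x -> c <= cabs (u x)) -> (forall x, D x -> c <= cabs (v x)) ->
  (forall x, D x -> cabs (u x - v x) <= c / 2) ->
  approx u -> approx v -> approx (fun x => (u x)^-1) -> approx (fun x => (v x)^-1).
Proof.
move=> c0 uc vc uv au av aui; apply: approx_uniform_limit => e e0.
have N0 f : (forall x, D x -> c <= cabs (f x)) -> forall x, D x -> f x != 0.
  by move=> fc x Dx; rewrite -cabs_gt0 (lt_le_trans c0) ?fc.
pose h x := (u x - v x) / u x.
have ah : approx h.
  apply: approxM => //; apply: (@approx_eq (fun x => u x + (-1) * v x)).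
    by move=> x _; ring.
  by apply: approxD => //; apply: approxM => //; exact: approx_cst.
have h2 x : D x -> cabs (h x) <= 2^-1.
  move=> Dx; rewrite cabsM cabsV ler_pdivrMr ?(lt_le_trans c0) ?uc //.
  apply: le_trans (uv _ Dx) _; rewrite mulrC ler_pM2l ?invr_gt0 //; exact: uc.
(* The remainder of the series after [k] terms is h^k / v, of modulus at most 2^-k / c. *)
have [k ke] : exists k : nat, (2^-1 : R) ^+ k <= e * c.
  have /cvgrPdist_le /(_ _ (mulr_gt0 e0 c0)) : ((2^-1 : R) ^+ k @[k --> \oo] --> 0).
    apply: cvg_expr; rewrite ger0_norm ?invr_ge0 // invf_lt1 //.
    by rewrite (ltr_nat _ 1 2).
  case=> k _ /(_ k (leqnn k)); rewrite sub0r normrN ger0_norm ?exprn_ge0 ?invr_ge0 //.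
  by exists k.
have asum j : approx (fun x => \sum_(i < j) h x ^+ i).
  elim: j => [|j IH].
    by apply: approx_eq (approx_cst 0) => x _; rewrite big_ord0.
  apply: (@approx_eq (fun x => 1 + h x * \sum_(i < j) h x ^+ i)).
    move=> x _; rewrite big_ord_recl expr0; congr (_ + _); rewrite mulr_sumr.
    by apply: eq_bigr => i _; rewrite -exprS.
  by apply: approxD; [exact: approx_cst|exact: approxM].
exists (fun x => (u x)^-1 * \sum_(i < k) h x ^+ i); first exact: approxM.
move=> x Dx; have u0 := N0 _ uc _ Dx; have v0 := N0 _ vc _ Dx.
(* Since 1 - h = v / u, the truncated geometric series has an exact remainder. *)
have -> : (v x)^-1 - (u x)^-1 * (\sum_(i < k) h x ^+ i) = h x ^+ k / v x.
  have : (1 - h x) * (\sum_(i < k) h x ^+ i) = 1 - h x ^+ k.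
    by rewrite -[RHS]opprB subrX1; ring.
  move: (h x ^+ k) (\sum_(i < k) _) => H S.
  have -> : 1 - h x = v x / u x by rewrite /h; field.
  move=> /(congr1 (fun y => y / v x)) e'.
  have -> : (u x)^-1 * S = v x / u x * S / v x by field; rewrite u0 v0.
  by rewrite e'; field.
rewrite cabsM cabsX cabsV ler_pdivrMr ?cabs_gt0 //.
apply: (le_trans (y := (2^-1) ^+ k)); first by rewrite lerXn2r ?nnegrE ?cabs_ge0 ?invr_ge0 // h2.
by apply: le_trans ke _; rewrite ler_pM2l // vc.
Qed.

End UniformApproximation.

(** * The inverse of a stable polynomial lies in the bidisk algebra *)

Section StableInverse.
Context {R : realType}.
Notation TT := (measurableTypeR R * measurableTypeR R)%type.
Notation D := (tdom R : set TT).
Implicit Types (p q : {poly {poly R[i]}}).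

Notation R3 := (R * (R * R))%type.

Definition ccont (X : topologicalType) (f : X -> R[i]) : Prop :=
  continuous (fun x => complex.Re (f x)) /\ continuous (fun x => complex.Im (f x)).

Lemma ccont_cst (X : topologicalType) c : @ccont X (fun=> c).
Proof. by split => x; exact: cvg_cst. Qed.

Lemma ccontD (X : topologicalType) (f g : X -> R[i]) :
  ccont f -> ccont g -> ccont (fun x => f x + g x).
Proof.
move=> [f1 f2] [g1 g2]; split.
  have -> : (fun x => complex.Re (f x + g x)) = (fun x => complex.Re (f x) + complex.Re (g x)).
    by apply/funext => x; rewrite raddfD.
  by move=> x; apply: cvgD; [exact: f1|exact: g1].
have -> : (fun x => complex.Im (f x + g x)) = (fun x => complex.Im (f x) + complex.Im (g x)).
  by apply/funext => x; rewrite raddfD.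
by move=> x; apply: cvgD; [exact: f2|exact: g2].
Qed.

Lemma ccontM (X : topologicalType) (f g : X -> R[i]) :
  ccont f -> ccont g -> ccont (fun x => f x * g x).
Proof.
move=> [f1 f2] [g1 g2].
split.
  have -> : (fun x => complex.Re (f x * g x)) =
    (fun x => complex.Re (f x) * complex.Re (g x) - complex.Im (f x) * complex.Im (g x)).
    by apply/funext => x; case: (f x) (g x) => [? ?] [? ?].
  by move=> x; apply: cvgB; apply: cvgM; [exact: f1|exact: g1|exact: f2|exact: g2].
have -> : (fun x => complex.Im (f x * g x)) =
  (fun x => complex.Re (f x) * complex.Im (g x) + complex.Im (f x) * complex.Re (g x)).
  by apply/funext => x; case: (f x) (g x) => [? ?] [? ?].
by move=> x; apply: cvgD; apply: cvgM; [exact: f1|exact: g2|exact: f2|exact: g1].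
Qed.

Lemma ccont_real (X : topologicalType) (f : X -> R) : continuous f -> ccont (fun x => (f x)%:C%C).
Proof. by move=> cf; split => x /=; [exact: cf | exact: cvg_cst]. Qed.

Lemma ccont_torus_pt (X : topologicalType) (f : X -> R) : continuous f ->
  ccont (fun x => torus_pt (f x)).
Proof.
move=> cf.
have c2 : continuous (fun x => 2 * pi * f x).
  by move=> x; apply: cvgM; [exact: cvg_cst | exact: cf].
by split => x /=; (apply: (continuous_comp (c2 x)); [exact: continuous_cos || exact: continuous_sin]).
Qed.

Lemma cabs_scaled_torus_pt (r t : R) : 0 <= r <= 1 -> sqn (r%:C%C * torus_pt t) <= 1.
Proof.
move=> /andP[r0 r1]; rewrite -sqr_cabs cabsM cabs_torus_pt cabs_real mulr1 ger0_norm //.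
by rewrite expr_le1.
Qed.

(** A minimum over a compact set. The radius [r] is a third compact parameter, so that one [c]
    serves all dilates p(r z, r w) in [approx_inv_stable]. *)
Lemma stable_lower_bound p : stable p -> exists2 c : R, 0 < c &
  forall r t s : R, 0 <= r <= 1 -> 0 <= t <= 1 -> 0 <= s <= 1 ->
    c <= cabs (eval2 p (r%:C%C * torus_pt t) (r%:C%C * torus_pt s)).
Proof.
move=> sp.
pose F (x : R3) := eval2 p (x.1%:C%C * torus_pt x.2.1) (x.1%:C%C * torus_pt x.2.2).
have [cF1 cF2] : ccont F.
  have c1 : continuous (fun x : R3 => x.1) by move=> x; exact: cvg_fst.
  have c2 : continuous (fun x : R3 => x.2.1).
    by move=> x; apply: (@continuous_comp _ _ _ (fun x : R3 => x.2) fst); [exact: cvg_snd|exact: cvg_fst].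
  have c3 : continuous (fun x : R3 => x.2.2).
    by move=> x; apply: (@continuous_comp _ _ _ (fun x : R3 => x.2) snd); exact: cvg_snd.
  apply: (eval2_ind (P := @ccont R3)).
  - exact: ccont_cst.
  - exact: ccontD.
  - exact: ccontM.
  - by apply: ccontM; [exact: ccont_real | exact: ccont_torus_pt].
  - by apply: ccontM; [exact: ccont_real | exact: ccont_torus_pt].
have csF : continuous (fun x => sqn (F x)).
  by move=> x; apply: cvgD; apply: cvgM; do ?[exact: cF1|exact: cF2].
pose A : set R3 := `[0, 1]%classic `*` (`[0, 1]%classic `*` `[0, 1]%classic).
have cA : compact A by do 2?[apply: compact_setX]; exact: segment_compact.
have A0 : A !=set0 by exists (0, (0, 0)); do 2?split => /=; rewrite in_itv /= lexx ler01.
have [[r0 [t0 s0]]] := compact_EVT_min A0 cA (continuous_subspaceT csF).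
rewrite inE => -[/= r01 _] Fmin.
have F0 : 0 < sqn (F (r0, (t0, s0))).
  by rewrite sqn_gt0; apply: sp; apply: cabs_scaled_torus_pt; move: r01; rewrite in_itv.
exists (cabs (F (r0, (t0, s0)))); first by rewrite cabs_gt0 -sqn_gt0.
move=> r t s hr ht hs; apply: ler_wsqrtr; apply: (Fmin (r, (t, s))).
by rewrite inE; do 2?split => /=; rewrite in_itv.
Qed.

Lemma eval2_radial_lipschitz p : exists2 M : R, 0 < M &
  forall r r' t s : R, 0 <= r <= 1 -> 0 <= r' <= 1 ->
  cabs (eval2 p (r%:C%C * torus_pt t) (r%:C%C * torus_pt s) -
        eval2 p (r'%:C%C * torus_pt t) (r'%:C%C * torus_pt s)) <= M * `|r - r'|.
Proof.
(* A Lipschitz bound alone is not inherited by products; the sup bound is carried along with it. *)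
pose P (f : R3 -> R[i]) := exists2 M : R, 0 < M & forall r r' t s : R, 0 <= r <= 1 -> 0 <= r' <= 1 ->
  cabs (f (r, (t, s))) <= M /\ cabs (f (r, (t, s)) - f (r', (t, s))) <= M * `|r - r'|.
have : P (fun x => eval2 p (x.1%:C%C * torus_pt x.2.1) (x.1%:C%C * torus_pt x.2.2)).
  have PZ (h : R * R -> R) : P (fun x => x.1%:C%C * torus_pt (h x.2)).
    exists 1 => // r r' t s r1 r1' /=.
    rewrite -mulrBl !cabsM cabs_torus_pt !mulr1 mul1r -rmorphB /= !cabs_real; split => //.
    by case/andP: r1 => r0 r1; rewrite ger0_norm.
  apply: (eval2_ind (P := P)); last 2 first.
  - exact: (PZ fst).
  - exact: (PZ snd).
  - move=> c; exists (cabs c + 1) => [|r r' t s _ _]; first by rewrite ltr_wpDl ?cabs_ge0.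
    by rewrite lerDl ler01 subrr cabs0 mulr_ge0 // addr_ge0 ?cabs_ge0.
  - move=> f g [M M0 fM] [N N0 gN]; exists (M + N) => [|r r' t s r1 r1']; first by rewrite addr_gt0.
    have [f1 f2] := fM r r' t s r1 r1'; have [g1 g2] := gN r r' t s r1 r1'; split.
      by apply: le_trans (cabsD _ _) _; rewrite lerD.
    by rewrite opprD addrACA mulrDl; apply: le_trans (cabsD _ _) _; rewrite lerD.
  - move=> f g [M M0 fM] [N N0 gN]; exists (M * N + M * N) => [|r r' t s r1 r1'].
      by rewrite addr_gt0 // mulr_gt0.
    have [f1 f2] := fM r r' t s r1 r1'; have [g1 g2] := gN r r' t s r1 r1'.
    have [f1' _] := fM r' r t s r1' r1; split.
      rewrite cabsM; apply: (@le_trans _ _ (M * N)).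
        by rewrite ler_pM ?cabs_ge0.
      by rewrite lerDl mulr_ge0 ?ltW.
    set a := f _; set b := g _; set a' := f _; set b' := g _.
    have -> : a * b - a' * b' = (a - a') * b + a' * (b - b') by ring.
    apply: le_trans (cabsD _ _) _; rewrite !cabsM mulrDl; apply: lerD.
      by rewrite mulrAC ler_pM ?cabs_ge0.
    by rewrite -mulrA ler_pM ?cabs_ge0.
move=> [M M0 H]; exists M => // r r' t s r1 r1'.
by have [_] := H r r' t s r1 r1'.
Qed.

(* Continuation along the dilates z |-> r z: 1/p(r z, r w) is constant at r = 0,
   and each step from r to r + 1/N is covered by approx_inv_near. *)
Lemma approx_inv_stable p : stable p -> approx (fun x => (teval p x)^-1).
Proof.
move=> sp; have [c c0 pc] := stable_lower_bound sp.
have [M M0 pM] := eval2_radial_lipschitz p.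
(* A step of length 1/N changes p by at most M / N <= c / 2, the distance allowed by
   [approx_inv_near]. *)
pose N := (Num.trunc (M / (c / 2))).+1.
have Nc : M / N%:R <= c / 2.
  rewrite ler_pdivrMr ?ltr0n // -ler_pdivrMl ?divr_gt0 // mulrC ltW //.
  exact: truncnS_gt.
pose u (k : nat) (x : TT) := eval2 p ((k%:R / N%:R : R)%:C%C * torus_pt x.1)
  ((k%:R / N%:R : R)%:C%C * torus_pt x.2).
have au k : approx (u k).
  apply: (eval2_ind (P := approx)).
  - exact: approx_cst.
  - exact: approxD.
  - exact: approxM.
  - by apply: approxM; [exact: approx_cst | exact: approx_fst].
  - by apply: approxM; [exact: approx_cst | exact: approx_snd].
have kN k : (k <= N)%N -> 0 <= (k%:R / N%:R : R) <= 1.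
  by move=> h; rewrite divr_ge0 //= ler_pdivrMr ?ltr0n // mul1r ler_nat.
have uc k x : (k <= N)%N -> D x -> c <= cabs (u k x).
  move=> h [/= x1 x2]; apply: pc; first exact: kN.
    by move: x1; rewrite in_itv.
  by move: x2; rewrite in_itv.
have H k : (k <= N)%N -> approx (fun x => (u k x)^-1).
  elim: k => [_|k IH kN1].
    apply: approx_eq (approx_cst (eval2 p 0 0)^-1) => x _.
    by rewrite /u mul0r rmorph0 !mul0r.
  apply: (approx_inv_near (u := u k) c0) => //.
  - by move=> x Dx; apply: uc => //; exact: ltnW.
  - by move=> x Dx; apply: uc.
  - move=> x Dx; apply: le_trans (pM _ _ _ _ (kN _ (ltnW kN1)) (kN _ kN1)) _.
    apply: le_trans Nc; rewrite ler_pM2l // -mulrBl -natr1 opprD addrA subrr sub0r.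
    by rewrite mulN1r normrN ger0_norm ?invr_ge0.
  - exact/IH/ltnW.
apply: approx_eq (H N (leqnn N)) => x _.
by rewrite /u divff ?pnatr_eq0 // rmorph1 !mul1r.
Qed.

Lemma stable_teval_lower_bound p : stable p ->
  exists2 c : R, 0 < c & forall x, D x -> c <= cabs (teval p x).
Proof.
move=> sp; have [c c0 pc] := stable_lower_bound sp; exists c => // x [/= x1 x2].
have := pc 1 x.1 x.2; rewrite rmorph1 !mul1r ler01 lexx /=; exact.
Qed.

End StableInverse.

(** * The weighted inner product *)

Section WeightedSpace.
Context {R : realType}.
Notation TT := (measurableTypeR R * measurableTypeR R)%type.
Notation mu := (tmeas R).
Notation D := (tdom R : set TT).
Variable p : {poly {poly R[i]}}.
Hypothesis sp : stable p.
Implicit Types (f g h : TT -> R[i]).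

(** [l2], [tip] and [tnsq] restate [L2], [ip] and [nsq] for functions of the two angles, so that
    values off the torus disappear from the argument. *)
Definition l2 f : Prop :=
  cmeas f /\ mu.-integrable D (EFin \o (fun x => sqn (f x) * wt p x)).

Definition tip f g : R[i] := cint (fun x => f x * conjc (g x) * (wt p x)%:C%C).

Definition tnsq f : R := Rintegral mu D (fun x => sqn (f x) * wt p x).

Lemma wt_ge0 x : 0 <= wt p x.
Proof. by rewrite invr_ge0 sqn_ge0. Qed.

Lemma measurable_wt : measurable_fun D (wt p).
Proof.
apply: measurable_invr => [x|]; first exact: sqn_ge0.
exact: (cmeas_sqn (cmeas_teval p)).
Qed.

Lemma wtE x : wt p x = (cabs (teval p x) ^+ 2)^-1.
Proof. by rewrite sqr_cabs. Qed.

Lemma wt_bounded : exists2 M : R, 0 < M & forall x, D x -> wt p x <= M.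
Proof.
have [c c0 pc] := stable_teval_lower_bound sp.
exists (c ^+ 2)^-1 => [|x Dx]; first by rewrite invr_gt0 exprn_gt0.
rewrite wtE lef_pV2 ?posrE ?exprn_gt0 //; last exact: lt_le_trans (pc _ Dx).
by rewrite lerXn2r ?nnegrE ?cabs_ge0 ?pc // ltW.
Qed.

Lemma L2P F : L2 p F <-> l2 (Defs.lift F).
Proof.
have mwt (mF : cmeas (Defs.lift F)) : measurable_fun D (fun x => sqn (Defs.lift F x) * wt p x).
  by apply: measurable_funM; [exact: cmeas_sqn | exact: measurable_wt].
have ge0 x : (0 <= (sqn (Defs.lift F x) * wt p x)%:E)%E.
  by rewrite lee_fin mulr_ge0 ?sqn_ge0 ?wt_ge0.
have absE : abse \o (EFin \o (fun x : TT => sqn (Defs.lift F x) * wt p x)) =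
    (fun x : TT => (sqn (Defs.lift F x) * wt p x)%:E).
  by apply/funext => x; rewrite /= ger0_norm ?mulr_ge0 ?sqn_ge0 ?wt_ge0.
split=> [[m1 m2 fin]|[[m1 m2] /integrableP[_]]].
  split; first by split.
  apply/integrableP; split; first by apply/measurable_EFinP; apply: mwt.
  by rewrite -[X in integral _ _ X]/(abse \o _) absE; exact: fin.
rewrite -[X in integral _ _ X]/(abse \o _) absE => fin; split; [exact: m1|exact: m2|exact: fin].
Qed.

Lemma ipE F G : ip p F G = tip (Defs.lift F) (Defs.lift G).
Proof.
rewrite /ip /tip /cint; congr Complex; apply: eq_Rintegral => x _;
  case: (Defs.lift F x * conjc (Defs.lift G x)) => a b /=.
  by rewrite mulr0 subr0.
by rewrite mulr0 add0r.
Qed.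

Lemma nsqE F : nsq p F = tnsq (Defs.lift F). Proof. by []. Qed.

Lemma tip_cintegrable f g : l2 f -> l2 g ->
  cintegrable (fun x => f x * conjc (g x) * (wt p x)%:C%C).
Proof.
move=> [mf if_] [mg ig].
apply: (@cintegrable_dominated _ _ (fun x => sqn (f x) * wt p x + sqn (g x) * wt p x)).
- by apply: cmeasM; [apply: cmeasM => //; exact: cmeas_conj | exact: cmeasR measurable_wt].
- exact: (integrableD measurable_tdom if_ ig).
- move=> x _; rewrite !cabsM cabs_conj cabs_real ger0_norm ?wt_ge0 // -mulrDl.
  rewrite ler_wpM2r ?wt_ge0 // -!sqr_cabs.
  have := sqr_ge0 (cabs (f x) - cabs (g x)).
  have := mulr_ge0 (cabs_ge0 (f x)) (cabs_ge0 (g x)).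
  by move: (cabs _) (cabs _) => a b; nra.
Qed.

Lemma l2_bounded f : cmeas f -> tbounded f -> l2 f.
Proof.
move=> mf [M M0 fM]; split => //; have [N N0 wN] := wt_bounded.
apply: (@integrable_dominated _ _ (fun=> M ^+ 2 * N)); last 2 first.
- exact: integrable_tdom_cst.
- move=> x Dx; rewrite ger0_norm ?mulr_ge0 ?sqn_ge0 ?wt_ge0 //.
  rewrite ler_pM ?sqn_ge0 ?wt_ge0 ?wN // -sqr_cabs.
  by rewrite lerXn2r ?nnegrE ?cabs_ge0 ?fM // ltW.
- by apply: measurable_funM; [exact: cmeas_sqn | exact: measurable_wt].
Qed.

Lemma l2_teval q : l2 (teval q).
Proof. by apply: l2_bounded; [exact: cmeas_teval | exact: tbounded_teval]. Qed.

Lemma l2_tmono a b : l2 (tmono a b).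
Proof.
apply: l2_bounded; first exact: cmeas_tmono.
by apply: tbounded_unimodular => x; exact: cabs_tmono.
Qed.

Lemma l2Z (c : R[i]) f : l2 f -> l2 (fun x => c * f x).
Proof.
move=> [mf if_]; split; first by apply: cmeasM => //; exact: cmeas_cst.
have -> : (fun x => sqn (c * f x) * wt p x) = (fun x => sqn c * (sqn (f x) * wt p x)).
  by apply/funext => x; rewrite -!sqr_cabs cabsM exprMn mulrA.
exact: integrableZ_real.
Qed.

Lemma l2D f g : l2 f -> l2 g -> l2 (fun x => f x + g x).
Proof.
move=> [mf if_] [mg ig]; split; first exact: cmeasD.
apply: (@integrable_dominated _ _ (fun x => 2 * (sqn (f x) * wt p x) + 2 * (sqn (g x) * wt p x))).
- by apply: measurable_funM; [apply: cmeas_sqn; exact: cmeasD | exact: measurable_wt].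
- exact: (integrableD measurable_tdom (integrableZ_real 2 if_) (integrableZ_real 2 ig)).
- move=> x _; rewrite ger0_norm ?mulr_ge0 ?sqn_ge0 ?wt_ge0 //.
  rewrite !mulrA -mulrDl ler_wpM2r ?wt_ge0 // /sqn.
  case: (f x) (g x) => [a b] [c d] /=.
  have := sqr_ge0 (a - c); have := sqr_ge0 (b - d); nra.
Qed.

Lemma l2B f g : l2 f -> l2 g -> l2 (fun x => f x - g x).
Proof.
move=> lf lg; have -> : (fun x => f x - g x) = (fun x => f x + (-1) * g x).
  by apply/funext => x; rewrite mulN1r.
by apply: l2D => //; exact: l2Z.
Qed.

Lemma l2_0 : l2 (fun=> 0).
Proof. by apply: l2_bounded; [exact: cmeas_cst | exact: tbounded_cst]. Qed.

Lemma l2_sum (I : Type) (r : seq I) (P : pred I) (F : I -> TT -> R[i]) :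
  (forall i, P i -> l2 (F i)) -> l2 (fun x => \sum_(i <- r | P i) F i x).
Proof.
move=> lF; elim: r => [|i r IH].
  by under eq_fun do rewrite big_nil; exact: l2_0.
under eq_fun do rewrite big_cons.
have [Pi|_] := boolP (P i); last exact: IH.
by apply: l2D => //; exact: lF.
Qed.

Lemma tipC f g : l2 f -> l2 g -> tip g f = conjc (tip f g).
Proof.
move=> lf lg; rewrite /tip -cint_conj; last exact: tip_cintegrable.
apply: eq_cint => x _; by rewrite !conjcM conjcK conjc_real (mulrC (g x)).
Qed.

Lemma tipDl f g h : l2 f -> l2 g -> l2 h ->
  tip (fun x => f x + g x) h = tip f h + tip g h.
Proof.
move=> lf lg lh; rewrite /tip -cintD; try exact: tip_cintegrable.
by apply: eq_cint => x _; rewrite !mulrDl.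
Qed.

Lemma tipZl c f h : l2 f -> l2 h -> tip (fun x => c * f x) h = c * tip f h.
Proof.
move=> lf lh; rewrite /tip -cintZ; try exact: tip_cintegrable.
by apply: eq_cint => x _; rewrite !mulrA.
Qed.

Lemma tipBl f g h : l2 f -> l2 g -> l2 h ->
  tip (fun x => f x - g x) h = tip f h - tip g h.
Proof.
move=> lf lg lh; have -> : (fun x => f x - g x) = (fun x => f x + (-1) * g x).
  by apply/funext => x; rewrite mulN1r.
by rewrite tipDl ?tipZl ?mulN1r //; exact: l2Z.
Qed.

Lemma tipDr f g h : l2 f -> l2 g -> l2 h ->
  tip h (fun x => f x + g x) = tip h f + tip h g.
Proof.
move=> lf lg lh.
by rewrite tipC ?tipDl ?conjcD -?tipC //; exact: l2D.
Qed.

Lemma tipZr c f h : l2 f -> l2 h -> tip h (fun x => c * f x) = conjc c * tip h f.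
Proof.
move=> lf lh.
by rewrite tipC ?tipZl ?conjcM -?tipC //; exact: l2Z.
Qed.

Lemma tipBr f g h : l2 f -> l2 g -> l2 h ->
  tip h (fun x => f x - g x) = tip h f - tip h g.
Proof.
move=> lf lg lh.
by rewrite tipC ?tipBl ?conjcB -?tipC //; exact: l2B.
Qed.

Lemma tip0l h : tip (fun=> 0) h = 0.
Proof.
rewrite /tip (@eq_cint _ _ (fun=> 0)).
  by rewrite /cint /= Rintegral_cst ?mul0r//; exact: measurable_tdom.
by move=> x _; rewrite !mul0r.
Qed.

Lemma tip_suml (I : Type) (r : seq I) (P : pred I) (F : I -> TT -> R[i]) h :
  (forall i, P i -> l2 (F i)) -> l2 h ->
  tip (fun x => \sum_(i <- r | P i) F i x) h = \sum_(i <- r | P i) tip (F i) h.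
Proof.
move=> lF lh; elim: r => [|i r IH].
  by rewrite big_nil; under eq_fun do rewrite big_nil; exact: tip0l.
rewrite big_cons; under eq_fun do rewrite big_cons.
have [Pi|_] := boolP (P i); last exact: IH.
by rewrite tipDl ?IH //; [exact: lF | exact: l2_sum].
Qed.

Lemma tip_sumr (I : Type) (r : seq I) (P : pred I) (F : I -> TT -> R[i]) h :
  (forall i, P i -> l2 (F i)) -> l2 h ->
  tip h (fun x => \sum_(i <- r | P i) F i x) = \sum_(i <- r | P i) tip h (F i).
Proof.
move=> lF lh; rewrite tipC ?tip_suml ?conjc_sum //; last exact: l2_sum.
by apply: eq_bigr => i Pi; rewrite -tipC //; exact: lF.
Qed.

Lemma tip_self f : tip f f = (tnsq f)%:C%C.
Proof.
rewrite /tip (@eq_cint _ _ (fun x => (sqn (f x) * wt p x)%:C%C)).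
  rewrite /cint /= Rintegral_cst ?mul0r //; exact: measurable_tdom.
by move=> x _; rewrite mul_conjc rmorphM.
Qed.

Lemma tnsq_ge0 f : 0 <= tnsq f.
Proof. by apply: Rintegral_ge0 => x _; rewrite mulr_ge0 ?sqn_ge0 ?wt_ge0. Qed.

Lemma cauchy_schwarz_sqr f g : l2 f -> l2 g -> sqn (tip f g) <= tnsq f * tnsq g.
Proof.
move=> lf lg.
(* This is the squared norm of f - t <f,g> g. The factor <f,g> in the coefficient makes the
   expansion a real quadratic in t. *)
have key (t : R) : 0 <= tnsq f - 2 * t * sqn (tip f g) + t ^+ 2 * sqn (tip f g) * tnsq g.
  pose c : R[i] := t%:C%C * tip f g.
  have lcg : l2 (fun x => c * g x) by exact: l2Z.
  have := tnsq_ge0 (fun x => f x - c * g x); rewrite -lecR -tip_self.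
  rewrite tipBl ?tipBr //; try exact: l2B.
  rewrite tipZr // tipZl // tipZl // tipZr // (tipC lf lg) !tip_self.
  have -> : conjc c = t%:C%C * conjc (tip f g) by rewrite /c conjcM conjc_real.
  have -> : (tnsq f)%:C%C - t%:C%C * conjc (tip f g) * tip f g -
    (c * conjc (tip f g) - c * (t%:C%C * conjc (tip f g) * (tnsq g)%:C%C)) =
    (tnsq f)%:C%C - 2 * t%:C%C * (tip f g * conjc (tip f g)) +
    t%:C%C ^+ 2 * (tip f g * conjc (tip f g)) * (tnsq g)%:C%C.
    by rewrite /c; ring.
  rewrite mul_conjc -(rmorph_nat (real_complex R) 2) -!rmorphXn -!rmorphM /= -rmorphB -rmorphD /=.
  by rewrite lecR.
have s0 := sqn_ge0 (tip f g); have n0 := tnsq_ge0 f; have m0 := tnsq_ge0 g.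
(* A vanishing norm does not make [g] vanish pointwise. The quadratic is then affine in t, and if
   <f,g> were nonzero, the t chosen below would give it the value -1. *)
have [g0|g0] := eqVneq (tnsq g) 0.
  rewrite g0 mulr0 leNgt; apply/negP => spos.
  have := key ((tnsq f + 1) / (2 * sqn (tip f g))); rewrite g0 mulr0 addr0.
  have -> : 2 * ((tnsq f + 1) / (2 * sqn (tip f g))) * sqn (tip f g) = tnsq f + 1.
    by field; rewrite gt_eqF.
  by lra.
have gpos : 0 < tnsq g by rewrite lt0r g0.
have := key (tnsq g)^-1.
have -> : tnsq f - 2 * (tnsq g)^-1 * sqn (tip f g) +
   (tnsq g)^-1 ^+ 2 * sqn (tip f g) * tnsq g = tnsq f - sqn (tip f g) / tnsq g by field.
by rewrite subr_ge0 ler_pdivrMr.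
Qed.

Definition tnorm f : R := Num.sqrt (tnsq f).

Lemma tnorm_ge0 f : 0 <= tnorm f. Proof. exact: sqrtr_ge0. Qed.

Lemma sqr_tnorm f : tnorm f ^+ 2 = tnsq f.
Proof. by rewrite sqr_sqrtr ?tnsq_ge0. Qed.

Lemma cauchy_schwarz f g : l2 f -> l2 g -> cabs (tip f g) <= tnorm f * tnorm g.
Proof.
move=> lf lg; rewrite -sqrtrM ?tnsq_ge0 //; apply: ler_wsqrtr.
exact: cauchy_schwarz_sqr.
Qed.

Lemma tnorm_triangle f g : l2 f -> l2 g -> tnorm (fun x => f x + g x) <= tnorm f + tnorm g.
Proof.
move=> lf lg; rewrite -(@ler_pXn2r _ 2) ?nnegrE ?addr_ge0 ?tnorm_ge0 //.
rewrite sqr_tnorm sqrrD !sqr_tnorm.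
have lfg := l2D lf lg.
have -> : tnsq (fun x => f x + g x) = tnsq f + complex.Re (tip f g) *+ 2 + tnsq g.
  apply: (@complexI R); rewrite -[LHS]tip_self tipDl // !tipDr // (tipC lf lg) !tip_self.
  case: (tip f g) => a b; apply/eqP; rewrite eq_complex /=; apply/andP;
    split; apply/eqP; ring.
rewrite lerD2r lerD2l lerMn2r /=.
apply: le_trans (cauchy_schwarz lf lg); apply: le_trans (normr_Re_le _); exact: ler_norm.
Qed.

(* Gram-Schmidt; if the last vector depends on the others, the quotient is 0 / 0 = 0. *)
Lemma residual_exists (k : nat) (v : nat -> TT -> R[i]) f : (forall i, l2 (v i)) -> l2 f ->
  exists c : nat -> R[i], forall i, (i < k)%N ->
    tip (fun x => f x - \sum_(j < k) c j * v j x) (v i) = 0.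
Proof.
move=> lv; have lS (k' : nat) (c : nat -> R[i]) : l2 (fun x => \sum_(j < k') c j * v j x).
  by apply: l2_sum => j _; exact: l2Z.
elim: k f => [|k IH] f lf; first by exists (fun=> 0).
have [c fc] := IH _ lf; have [d vd] := IH _ (lv k).
set r := (fun x => f x - _) in fc; set v' := (fun x => v k x - _) in vd.
have lr : l2 r by apply: l2B.
have lv' : l2 v' by apply: l2B.
pose al := tip r v' / (tnsq v')%:C%C.
have rv' : tip (fun x => r x - al * v' x) v' = 0.
  rewrite tipBl ?tipZl ?tip_self //; last exact: l2Z.
  (* If v' has norm 0, Cauchy-Schwarz already gives <r, v'> = 0. *)
  rewrite /al; have [v0|v0] := eqVneq (tnsq v') 0.
    rewrite v0 mulr0 subr0; apply/eqP; rewrite -cabs_eq0 -[_ == _](@expf_eq0 _ _ 2).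
    by rewrite sqr_cabs eq_le sqn_ge0 andbT -(mulr0 (tnsq r)) -v0 cauchy_schwarz_sqr.
  by rewrite divfK ?subrr // (inj_eq (@complexI R) _ 0).
have rvi i : (i < k)%N -> tip (fun x => r x - al * v' x) (v i) = 0.
  by move=> ik; rewrite tipBl ?tipZl ?fc ?vd ?mulr0 ?subrr //; exact: l2Z.
have lr' : l2 (fun x => r x - al * v' x) by apply: l2B => //; exact: l2Z.
exists (fun j => if (j < k)%N then c j - al * d j else al).
have -> : (fun x => f x - \sum_(j < k.+1) (if (j < k)%N then c j - al * d j else al) * v j x) =
          (fun x => r x - al * v' x).
  apply/funext => x; rewrite big_ord_recr /= ltnn /r /v'.
  have -> : \sum_(i < k) (if (i < k)%N then c i - al * d i else al) * v i x =
    \sum_(i < k) c i * v i x - al * \sum_(i < k) d i * v i x.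
    rewrite mulr_sumr -sumrB; apply: eq_bigr => i _.
    by rewrite ltn_ord mulrBl mulrA.
  by ring.
move=> i; rewrite ltnS leq_eqVlt => /orP[/eqP ->|]; last exact: rvi.
have -> : v k = (fun x => v' x + \sum_(j < k) d j * v j x).
  by apply/funext => x; rewrite /v' subrK.
rewrite tipDr // rv' add0r tip_sumr //; last by move=> j _; exact: l2Z.
by rewrite big1 // => j _; rewrite tipZr // rvi ?mulr0.
Qed.

End WeightedSpace.

(** * Fourier coefficients of quotients by p *)

Section FourierVanishing.
Context {R : realType}.
Notation TT := (measurableTypeR R * measurableTypeR R)%type.
Notation D := (tdom R : set TT).
Implicit Types (p q r : {poly {poly R[i]}}) (f g : TT -> R[i]).

Lemma cintegrable_bounded f : cmeas f -> tbounded f -> cintegrable f.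
Proof. by move=> mf [M _ fM]; exact: bounded_cintegrable fM. Qed.

Lemma teval_expand q (M N : nat) x : (size q <= M)%N ->
  (forall j, (j < M)%N -> (size (q`_j)%R <= N)%N) ->
  teval q x = \sum_(j < M) \sum_(i < N) q`_j`_i * tmono i j x.
Proof. by move=> qM qN; rewrite /teval (eval2_expand _ _ qM qN). Qed.

Lemma teval_wide_expand q : exists M N : nat, (size q <= M)%N /\
  forall x, teval q x = \sum_(j < M) \sum_(i < N) q`_j`_i * tmono i j x.
Proof.
have [N qN] := coef_sizes_bounded 1 (fun=> q).
by exists (size q), N; split => // x; apply: teval_expand => // j _; exact: (qN 0%N j).
Qed.

Lemma cmeas_tmono_teval a b q : cmeas (fun x => tmono a b x * teval q x).
Proof. by apply: cmeasM; [exact: cmeas_tmono | exact: cmeas_teval]. Qed.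

Lemma cint_tmono_teval_eq0 a b q : 0 < a \/ 0 < b ->
  cint (fun x => tmono a b x * teval q x) = 0.
Proof.
move=> ab; have [M [N [_ qE]]] := teval_wide_expand q.
have -> : (fun x => tmono a b x * teval q x) =
  (fun x => \sum_(j < M) \sum_(i < N) q`_j`_i * tmono (a + i) (b + j) x).
  apply/funext => x; rewrite qE mulr_sumr; apply: eq_bigr => j _.
  rewrite mulr_sumr; apply: eq_bigr => i _.
  by rewrite mulrCA tmonoD.
have iz j i : cintegrable (fun x : TT => q`_j`_i * tmono (a + Posz i) (b + Posz j) x).
  by apply: cintegrableZ; exact: cintegrable_tmono.
rewrite cint_sum; last by move=> j _; apply: cintegrable_sum => i _; exact: iz.
rewrite big1 // => j _; rewrite cint_sum // big1 // => i _.
rewrite cintZ ?cint_tmono; last exact: cintegrable_tmono.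
case: ab => h.
  by have -> : (a + Posz i == 0) = false; [apply/gt_eqF; rewrite ltr_pwDl | rewrite mulr0].
by have -> : (b + Posz j == 0) = false; [apply/gt_eqF; rewrite ltr_pwDl | rewrite andbF mulr0].
Qed.

(** 1/f = conj(f) / |f|^2, which also holds where f = 0 because inversion sends 0 to 0. *)
Lemma cmeas_inv f : cmeas f -> cmeas (fun x => (f x)^-1).
Proof.
move=> mf; have -> : (fun x => (f x)^-1) = (fun x => conjc (f x) * ((sqn (f x))^-1)%:C%C).
  apply/funext => x; have [->|fx] := eqVneq (f x) 0; first by rewrite conjc0 mul0r invr0.
  rewrite fmorphV /= -mul_conjc invfM mulrCA mulfV ?mulr1 //.
  by rewrite conjc_eq0.
apply: cmeasM; first exact: cmeas_conj.
apply: cmeasR; apply: measurable_invr; last exact: cmeas_sqn.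
by move=> x; exact: sqn_ge0.
Qed.

Lemma eq0_cabs (y : R[i]) : (forall eps : R, 0 < eps -> cabs y <= eps) -> y = 0.
Proof.
move=> H; apply/eqP; rewrite -cabs_eq0 eq_le cabs_ge0 andbT.
by apply/ler_addgt0Pl => e e0; rewrite addr0; exact: H.
Qed.

(** The integral is the Fourier coefficient of f at (-a, -b). It vanishes for polynomials as soon as
    one index is negative, and this survives uniform limits. *)
Lemma cint_approx_analytic_eq0 a b f : cmeas f -> approx f -> 0 < a \/ 0 < b ->
  cint (fun x => tmono a b x * f x) = 0.
Proof.
move=> mf af ab; apply: eq0_cabs => e e0.
have [q fq] := af (e / 2) (divr_gt0 e0 (@ltr0n R 2)).
have mg : cmeas (fun x => tmono a b x * (f x - teval q x)).
  apply: cmeasM; first exact: cmeas_tmono.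
  have -> : (fun x => f x - teval q x) = (fun x => f x + (-1) * teval q x).
    by apply/funext => x; rewrite mulN1r.
  apply: cmeasD => //; apply: cmeasM; [exact: cmeas_cst|exact: cmeas_teval].
have gb x : D x -> cabs (tmono a b x * (f x - teval q x)) <= e / 2.
  by move=> Dx; rewrite cabsM cabs_tmono mul1r fq.
have ig := bounded_cintegrable mg gb.
have iq : cintegrable (fun x => tmono a b x * teval q x).
  apply: cintegrable_bounded; first exact: cmeas_tmono_teval.
  apply: tboundedM; last exact: tbounded_teval.
  by apply: tbounded_unimodular => x; exact: cabs_tmono.
have -> : (fun x => tmono a b x * f x) =
  (fun x => tmono a b x * (f x - teval q x) + tmono a b x * teval q x).
  by apply/funext => x; rewrite -mulrDr subrK.
rewrite cintD // cint_tmono_teval_eq0 // addr0.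
by have := cabs_cint_le ig gb; lra.
Qed.

Variable p : {poly {poly R[i]}}.
Hypothesis sp : stable p.

Lemma approx_quotient q : approx (fun x => teval q x / teval p x).
Proof. by apply: approxM; [exact: approx_teval | exact: approx_inv_stable]. Qed.

Lemma cmeas_quotient q : cmeas (fun x => teval q x / teval p x).
Proof. by apply: cmeasM; [exact: cmeas_teval | apply: cmeas_inv; exact: cmeas_teval]. Qed.

Lemma cintegrable_tmono_quotient a b q :
  cintegrable (fun x => tmono a b x * (teval q x / teval p x)).
Proof.
apply: cintegrable_bounded; first by apply: cmeasM; [exact: cmeas_tmono|exact: cmeas_quotient].
apply: tboundedM; last exact/approx_bounded/approx_quotient.
by apply: tbounded_unimodular => x; exact: cabs_tmono.
Qed.

Lemma cint_quotient_eq0 a b q : 0 < a \/ 0 < b ->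
  cint (fun x => tmono a b x * (teval q x / teval p x)) = 0.
Proof. by apply: cint_approx_analytic_eq0; [exact: cmeas_quotient|exact: approx_quotient]. Qed.

Lemma tmono_conj_quotient a b q : (fun x => tmono a b x * conjc (teval q x / teval p x)) =
  (fun x => conjc (tmono (- a) (- b) x * (teval q x / teval p x))).
Proof. by apply/funext => x; rewrite [in RHS]conjcM tmono_conj !opprK. Qed.

Lemma cintegrable_tmono_conj_quotient a b q :
  cintegrable (fun x => tmono a b x * conjc (teval q x / teval p x)).
Proof.
rewrite tmono_conj_quotient; have [i1 i2] := cintegrable_tmono_quotient (- a) (- b) q.
apply: cintegrable_bounded.
  by apply/cmeas_conj/cmeasM; [exact: cmeas_tmono|exact: cmeas_quotient].
apply: tbounded_conj; apply: tboundedM; last exact/approx_bounded/approx_quotient.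
by apply: tbounded_unimodular => x; exact: cabs_tmono.
Qed.

Lemma cint_conj_quotient_eq0 a b q : a < 0 \/ b < 0 ->
  cint (fun x => tmono a b x * conjc (teval q x / teval p x)) = 0.
Proof.
move=> ab; rewrite tmono_conj_quotient cint_conj; last exact: cintegrable_tmono_quotient.
by rewrite cint_quotient_eq0 ?conjc0 // !oppr_gt0.
Qed.

Lemma teval_neq0 x : D x -> teval p x != 0.
Proof.
have [c c0 pc] := stable_teval_lower_bound sp.
by move=> Dx; rewrite -cabs_gt0 (lt_le_trans c0) ?pc.
Qed.

Lemma wtC x : (wt p x)%:C%C = (teval p x * conjc (teval p x))^-1.
Proof. by rewrite mul_conjc -fmorphV. Qed.

(* With r close to 1/p, the weight 1/|p|^2 is close to |r|^2, against which the
   inner product is a finite sum of Fourier coefficients. *)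
Lemma riemann_lebesgue q (eps : R) : 0 < eps ->
  exists i0 : nat, forall i j : nat, (i0 <= i)%N -> cabs (tip p (tmono i j) (teval q)) <= eps.
Proof.
move=> e0.
have aq : approx (fun x => teval q x / teval p x) by exact: approx_quotient.
have [N N0 pN] := approx_bounded (approx_inv_stable sp).
(* In the pairing, conj(q) / |p|^2 = conj(q/p) / p. Here [r] replaces q/p, while the factor 1/p,
   bounded by [N], is kept. *)
have [r qr] := aq (eps / 2 / N) (divr_gt0 (divr_gt0 e0 (@ltr0n R 2)) N0).
have [M [K [_ rE]]] := teval_wide_expand r.
exists K => i j Ki.
have mI : cmeas (fun x : TT => tmono i j x *
    (conjc (teval q x / teval p x - teval r x) * (teval p x)^-1)).
  apply: cmeasM; first exact: cmeas_tmono.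
  apply: cmeasM; last by apply: cmeas_inv; exact: cmeas_teval.
  apply: cmeas_conj.
  have -> : (fun x => teval q x / teval p x - teval r x) =
    (fun x => teval q x / teval p x + (-1) * teval r x).
    by apply/funext => x; rewrite mulN1r.
  apply: cmeasD; first exact: cmeas_quotient.
  by apply: cmeasM; [exact: cmeas_cst|exact: cmeas_teval].
have bI : forall x, D x -> cabs (tmono i j x *
    (conjc (teval q x / teval p x - teval r x) * (teval p x)^-1)) <= eps / 2 / N * N.
  move=> x Dx; rewrite cabsM cabs_tmono mul1r cabsM cabs_conj.
  by rewrite ler_pM ?cabs_ge0 ?qr ?pN.
have iI := bounded_cintegrable mI bI.
have key : tip p (tmono i j) (teval q) = cint (fun x => tmono i j x *
    (conjc (teval q x / teval p x - teval r x) * (teval p x)^-1)).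
  have E0 : (fun x => tmono i j x * (conjc (teval r x) * (teval p x)^-1)) =
    (fun x => \sum_(v < M) \sum_(u < K) conjc (r`_v`_u) *
       (tmono (Posz i - Posz u) (Posz j - Posz v) x * (teval 1 x / teval p x))).
    apply/funext => x; rewrite rE conjc_sum mulr_suml mulr_sumr; apply: eq_bigr => v _.
    rewrite conjc_sum mulr_suml mulr_sumr; apply: eq_bigr => u _.
    rewrite conjcM tmono_conj -tmonoD {2}/teval eval2C hornerC mul1r.
    by rewrite !mulrA; congr (_ * _); rewrite mulrAC -!mulrA; ring.
  have iz (u v : nat) : cintegrable (fun x : TT => conjc (r`_v`_u) *
       (tmono (Posz i - Posz u) (Posz j - Posz v) x * (teval 1 x / teval p x))).
    by apply: cintegrableZ; exact: cintegrable_tmono_quotient.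
  have i0 : cintegrable (fun x => tmono i j x * (conjc (teval r x) * (teval p x)^-1)).
    by rewrite E0; apply: cintegrable_sum => v _; apply: cintegrable_sum => u _.
  (* The part containing [r] vanishes exactly: its z-exponents u are below K <= i, so each term
     integrates z^(i-u) with i - u > 0 against 1/p. *)
  have z0 : cint (fun x => tmono i j x * (conjc (teval r x) * (teval p x)^-1)) = 0.
    rewrite E0 cint_sum; last by move=> v _; exact: cintegrable_sum.
    rewrite big1 // => v _; rewrite cint_sum // big1 // => u _.
    rewrite cintZ ?cint_quotient_eq0 ?mulr0 //; last exact: cintegrable_tmono_quotient.
    by left; rewrite subr_gt0 ltz_nat (leq_trans (ltn_ord u)).
  rewrite -[RHS]addr0 -z0 -cintD //; apply: eq_cint => x Dx.
  have p0 := teval_neq0 Dx.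
  rewrite wtC conjcB conjcM conjc_inv.
  have cp0 : conjc (teval p x) != 0 by rewrite conjc_eq0.
  by field; rewrite p0 cp0.
rewrite key; have -> : eps = (eps / 2 / N * N) *+ 2.
  by rewrite (@divfK _ N) ?gt_eqF // mulr2n -splitr.
exact: cabs_cint_le iI bI.
Qed.

End FourierVanishing.

(** * The Christoffel-Darboux polynomials *)

(** The natural numbers are pairwise distinct in [F], which gives more roots than the size
    permits. *)
Lemma poly_eq0_horner (F : numDomainType) (q : {poly F}) : (forall x, q.[x] = 0) -> q = 0.
Proof.
move=> q0; apply/eqP; apply: contraT => qn0.
have := @max_poly_roots _ q [seq i%:R | i <- iota 0 (size q)] qn0.
rewrite size_map size_iota ltnn => H; apply: H.
  by apply/allP => x _; rewrite /root q0.
rewrite map_inj_uniq ?iota_uniq // => i j /eqP.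
by rewrite eqr_nat => /eqP.
Qed.

Section ChristoffelDarboux.
Context {R : realType}.
Variables (n m : nat) (p : {poly {poly R[i]}}).
Hypotheses (pn : forall j, (size (p`_j)%R <= n.+1)%N) (pm : (size p <= m.+1)%N).
Implicit Types (z w x : R[i]).

(* revcoef u is z^n conj (p_u(1 / conj z)), where p = \sum_u p_u(z) w^u. *)
Definition revcoef (u : nat) : {poly R[i]} := \poly_(i < n.+1) conjc (p`_u`_(n - i)).

(** [ptilde] as an element of the polynomial ring, with no inverses in its definition. *)
Definition revpoly : {poly {poly R[i]}} := \sum_(u < m.+1) (revcoef u)%:P * 'X^(m - u).

(* The coefficient of conj(eta)^u in the numerator of L(z, w; eta), for |z| = 1. *)
Definition cdnum (u : nat) : {poly {poly R[i]}} :=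
  p * (revcoef u)%:P - revpoly * (p`_(m - u))%:P.

(** The coefficient of conj(eta)^j in the product of the numerator with the geometric series of 1 /
    (1 - w conj(eta)); hence the polynomial that a_j must be. *)
Definition cdpoly (j : nat) : {poly {poly R[i]}} := \sum_(u < j.+1) cdnum u * 'X^(j - u).

Lemma p_expand : p = \sum_(u < m.+1) (p`_u)%:P * 'X^u.
Proof.
transitivity (\poly_(u < m.+1) p`_u).
  apply/polyP => k; rewrite coef_poly; case: ltnP => // mk.
  by rewrite nth_default // (leq_trans pm).
by rewrite poly_def; apply: eq_bigr => u _; rewrite mul_polyC.
Qed.

(** [cdpoly m] is w^m times the numerator at conj(eta) = 1/w, where its two halves become p times
    [revpoly] and [revpoly] times p. So 1 - w conj(eta) divides the numerator. *)
Lemma cdpoly_top : cdpoly m = 0.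
Proof.
rewrite /cdpoly; under eq_bigr do rewrite mulrBl.
rewrite sumrB; apply/eqP; rewrite subr_eq0; apply/eqP.
have -> : \sum_(u < m.+1) p * (revcoef u)%:P * 'X^(m - u) = p * revpoly.
  by rewrite /revpoly mulr_sumr; apply: eq_bigr => u _; rewrite mulrA.
under eq_bigr do rewrite -mulrA.
rewrite -mulr_sumr mulrC; congr (_ * _); rewrite [LHS]p_expand.
rewrite (reindex_inj rev_ord_inj) /=; apply: eq_bigr => u _.
by rewrite subSS.
Qed.

Lemma cdpoly_split j : (j <= m)%N ->
  cdpoly j * 'X^(m - j) = - \sum_(j.+1 <= u < m.+1) cdnum u * 'X^(m - u).
Proof.
move=> jm; apply/eqP; rewrite -addr_eq0; apply/eqP; rewrite -[RHS]cdpoly_top /cdpoly.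
rewrite -!(big_mkord xpredT (fun u => cdnum u * 'X^(_ - u))).
rewrite [RHS](@big_cat_nat _ _ _ j.+1) //=; congr (_ + _).
rewrite mulr_suml !big_nat; apply: eq_bigr => u; rewrite ltnS => uj.
by rewrite -mulrA -exprD; congr (_ * 'X^_); lia.
Qed.

Lemma cdpolyS j : cdpoly j.+1 = cdpoly j * 'X + cdnum j.+1.
Proof.
rewrite /cdpoly big_ord_recr /= subnn expr0 mulr1; congr (_ + _).
rewrite mulr_suml; apply: eq_bigr => u _; rewrite -mulrA -exprSr -subSn //.
by rewrite -ltnS.
Qed.

Lemma size_revpoly : (size revpoly <= m.+1)%N.
Proof.
apply: (leq_trans (size_sum _ _ _)); apply/bigmax_leqP => u _.
apply: (leq_trans (size_polyMleq _ _)); rewrite size_polyXn size_polyC.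
by case: (_ != _) => /=; lia.
Qed.

Lemma size_cdnum u : (size (cdnum u) <= m.+1)%N.
Proof.
apply: (leq_trans (size_polyD _ _)); rewrite geq_max size_polyN; apply/andP; split.
  apply: (leq_trans (size_polyMleq _ _)).
  by rewrite size_polyC; case: (_ != _); rewrite ?addn1 ?addn0 //= (leq_trans (leq_pred _)).
apply: (leq_trans (size_polyMleq _ _)).
by rewrite size_polyC; case: (_ != _); rewrite ?addn1 ?addn0 ?size_revpoly //= (leq_trans (leq_pred _)) ?size_revpoly.
Qed.

(** The defining sum only bounds the w-degree by m + j. The complementary sum of [cdpoly_split] has
    degree at most m + (m - j - 1), and it equals [cdpoly j] times w^(m-j) up to sign. *)
Lemma size_cdpoly j : (j < m)%N -> (size (cdpoly j) <= m)%N.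
Proof.
move=> jm; have [->|A0] := eqVneq (cdpoly j) 0; first by rewrite size_poly0.
have := cdpoly_split (ltnW jm); move/(congr1 (fun q : {poly {poly R[i]}} => size q)).
rewrite size_Mmonic ?monicXn // size_polyXn size_polyN => E.
have : (size (\sum_(j.+1 <= u < m.+1) cdnum u * 'X^(m - u))%R <= m + m - j)%N.
  rewrite big_nat; apply: (leq_trans (size_sum _ _ _)).
  apply/bigmax_leqP_seq => u _ /andP[ju um].
  apply: (leq_trans (size_polyMleq _ _)); rewrite size_polyXn.
  by move: (size_cdnum u); move: (size (cdnum u)) => s; lia.
by rewrite -E; move: (size (cdpoly j)) => s; lia.
Qed.

Lemma revcoef_torus u z : sqn z = 1 -> (revcoef u).[z] = z ^+ n * conjc (p`_u).[z].
Proof.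
move=> z1; have z0 : z != 0 by rewrite -sqn_gt0 z1.
have zc : conjc z = z^-1 by apply: (mulfI z0); rewrite mul_conjc z1 divff.
rewrite horner_poly (horner_coef_wide _ (pn u)) conjc_sum mulr_sumr.
rewrite (reindex_inj rev_ord_inj) /=; apply: eq_bigr => i _.
have i_n : (i <= n)%N by rewrite -ltnS.
rewrite subSS subKn // conjcM mulrCA; congr (_ * _).
have -> : conjc (z ^+ i) = (z ^+ i)^-1 by rewrite -exprVn -zc; exact: rmorphXn.
by rewrite expfB_cond // (negbTE z0).
Qed.

Lemma revpoly_torus z w : sqn z = 1 -> sqn w = 1 ->
  eval2 revpoly z w = z ^+ n * w ^+ m * conjc (eval2 p z w).
Proof.
move=> z1 w1; have w0 : w != 0 by rewrite -sqn_gt0 w1.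
have wc : conjc w = w^-1 by apply: (mulfI w0); rewrite mul_conjc w1 divff.
rewrite eval2_sum (eval2_coef _ _ pm) conjc_sum mulr_sumr; apply: eq_bigr => u _.
rewrite eval2M eval2C eval2Xn revcoef_torus // conjcM.
have um : (u <= m)%N by rewrite -ltnS.
have -> : conjc (w ^+ u) = (w ^+ u)^-1 by rewrite -exprVn -wc; exact: rmorphXn.
by rewrite expfB_cond ?(negbTE w0) // [RHS]mulrACA.
Qed.

Lemma cdnum_torus u z w : sqn z = 1 -> sqn w = 1 -> eval2 (cdnum u) z w =
  eval2 p z w * (z ^+ n * conjc (p`_u).[z]) -
  z ^+ n * w ^+ m * conjc (eval2 p z w) * (p`_(m - u)).[z].
Proof.
move=> z1 w1.
by rewrite /cdnum eval2D eval2N !eval2M !eval2C revcoef_torus // revpoly_torus.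
Qed.

Variable a : nat -> R[i] -> R[i] -> R[i].
Hypothesis aL : forall z w eta : R[i], z != 0 -> w != 0 -> eta != 0 -> w * conjc eta != 1 ->
  \sum_(j < m) a j z w * (conjc eta) ^+ j =
  z ^+ n * (eval2 p z w * conjc (eval2 p (conjc z)^-1 eta)
            - ptilde n m p z w * conjc (ptilde n m p (conjc z)^-1 eta))
    / (1 - w * conjc eta).

Lemma cd_identity z w : sqn z = 1 -> sqn w = 1 ->
  (1 - w%:P * 'X) * \poly_(j < m) a j z w = \poly_(u < m.+1) eval2 (cdnum u) z w.
Proof.
move=> z1 w1; apply/eqP; rewrite -subr_eq0; apply/eqP.
have z0 : z != 0 by rewrite -sqn_gt0 z1.
have w0 : w != 0 by rewrite -sqn_gt0 w1.
have zc : conjc z = z^-1 by apply: (mulfI z0); rewrite mul_conjc z1 divff.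
have wc : conjc w = w^-1 by apply: (mulfI w0); rewrite mul_conjc w1 divff.
set Q := _ - _.
(* With x = conj(eta), the hypothesis on [a] says nothing at x = 0 and x = 1/w. Multiplying by a
   nonzero polynomial that vanishes there gives an identity at every x. *)
have nz : 'X * (1 - w%:P * 'X) != 0 :> {poly R[i]}.
  rewrite mulf_neq0 ?polyX_eq0 //; apply/eqP => /(congr1 (fun q : {poly R[i]} => q.[0])).
  by rewrite !hornerE ?mulr0 ?subr0 => /eqP; rewrite oner_eq0.
suff : 'X * (1 - w%:P * 'X) * Q = 0.
  by move/eqP; rewrite mulf_eq0 (negbTE nz) => /eqP.
apply: poly_eq0_horner => x; rewrite hornerM.
have -> : ('X * (1 - w%:P * 'X)).[x] = x * (1 - w * x) by rewrite !hornerE.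
have [->|x0] := eqVneq x 0; first by rewrite !mul0r.
have [->|wx] := eqVneq (w * x) 1; first by rewrite subrr mulr0 mul0r.
have wx0 : 1 - w * x != 0 by rewrite subr_eq0 eq_sym.
suff -> : Q.[x] = 0 by rewrite mulr0.
rewrite /Q hornerD hornerN; apply/eqP; rewrite subr_eq0; apply/eqP.
rewrite hornerM !horner_poly.
have -> : (1 - w%:P * 'X).[x] = 1 - w * x by rewrite !hornerE.
have := aL z0 w0 (eta := conjc x); rewrite conjc_eq0 conjcK => /(_ x0 wx) ->.
rewrite mulrC divfK // zc invrK.
rewrite (eval2_coef z (conjc x) pm) conjc_sum.
rewrite /ptilde !zc !wc !invrK conjcM conjcK conjcM.
have cX (y : R[i]) k : conjc (y ^+ k) = conjc y ^+ k by exact: rmorphXn.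
rewrite !cX conjcK zc (eval2_coef z x^-1 pm) [in LHS]mulr_sumr.
(* The factor eta^m in [ptilde] reverses the w-coefficients of p; this is where the index m - u of
   [cdnum] comes from. *)
have S2 : x ^+ m * (\sum_(j < m.+1) (p`_j).[z] * x^-1 ^+ j) =
    \sum_(u < m.+1) (p`_(m - u)).[z] * x ^+ u.
  rewrite mulr_sumr (reindex_inj rev_ord_inj); apply: eq_bigr => u _ /=.
  have um : (u <= m)%N by rewrite -ltnS.
  rewrite subSS mulrCA exprVn -expfB_cond ?(negbTE x0) ?leq_subr //.
  by rewrite subKn.
rewrite -(mulrA (z^-1 ^+ n)) S2.
rewrite [RHS](eq_bigr (fun u : 'I_m.+1 =>
  z ^+ n * (eval2 p z w * conjc ((p`_u).[z] * conjc x ^+ u)) -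
  z ^+ n * w ^+ m * conjc (eval2 p z w) * ((p`_(m - u)).[z] * x ^+ u))); last first.
  by move=> u _; rewrite cdnum_torus // conjcM cX conjcK; ring.
rewrite sumrB -!mulr_sumr mulrBr; congr (_ - _).
by rewrite exprVn; field; rewrite ?expf_neq0.
Qed.

(** Comparing coefficients in [cd_identity] gives a_k - w a_(k-1) = [cdnum k], which is the
    recurrence [cdpolyS]. *)
Lemma a_torus j z w : (j < m)%N -> sqn z = 1 -> sqn w = 1 -> a j z w = eval2 (cdpoly j) z w.
Proof.
move=> + z1 w1; have H k : (k < m.+1)%N ->
    eval2 (cdnum k) z w = (if (k < m)%N then a k z w else 0) -
      w * (if k is k'.+1 then a k' z w else 0).
  move=> km; have := congr1 (fun q : {poly R[i]} => q`_k) (cd_identity z1 w1).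
  rewrite coef_poly km => <-.
  rewrite mulrBl mul1r coefB coef_poly -mulrA coefCM coefXM; congr (_ - _ * _).
  by case: k km => //= k km; rewrite coef_poly (km : k < m)%N.
elim: j => [|j IH] jm.
  have := H 0%N (ltnW jm); rewrite jm mulr0 subr0 => <-.
  by rewrite /cdpoly big_ord1 subnn expr0 mulr1.
have := H j.+1 (ltnW jm); rewrite jm IH ?(ltnW jm) // => E.
rewrite cdpolyS eval2D eval2M eval2X E; ring.
Qed.

End ChristoffelDarboux.

(** * Biorthogonality of the z^k a_j to monomials *)

Section DualBasis.
Context {R : realType}.
Notation TT := (measurableTypeR R * measurableTypeR R)%type.
Notation D := (tdom R : set TT).
Variables (n m : nat) (p : {poly {poly R[i]}}).
Hypotheses (pn : forall j, (size (p`_j)%R <= n.+1)%N) (pm : (size p <= m.+1)%N).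
Hypothesis sp : stable p.

(** By [a_torus], this is z^k a_j on the torus when j < m. *)
Definition dual (k j : nat) (x : TT) : R[i] := tmono k 0 x * teval (cdpoly n m p j) x.

Lemma l2_dual k j : l2 p (dual k j).
Proof.
apply: l2_bounded => //; first exact: cmeas_tmono_teval.
apply: tboundedM; last exact: tbounded_teval.
by apply: tbounded_unimodular => x; exact: cabs_tmono.
Qed.

Lemma tevalC (q : {poly R[i]}) (x : TT) : teval q%:P x = q.[torus_pt x.1].
Proof. by rewrite /teval eval2C. Qed.

(** The sum of p_s w^s / p over all s <= m is 1. Passing to the tail s > j isolates one pure
    character and leaves terms with strictly larger w-exponents. *)
Lemma partial_quotient_sum (j : nat) (a b : int) (x : TT) : D x -> (j <= m)%N ->
  \sum_(s < j.+1) tmono a (b + s) x * (teval (p`_s)%:P x / teval p x) =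
  tmono a b x - \sum_(j.+1 <= s < m.+1) tmono a (b + Posz s) x * (teval (p`_s)%:P x / teval p x).
Proof.
move=> Dx jm; apply/eqP; rewrite eq_sym subr_eq; apply/eqP.
rewrite -(big_mkord xpredT (fun s => tmono a (b + Posz s) x * (teval (p`_s)%:P x / teval p x))).
rewrite -big_cat_nat //= big_mkord.
have -> : \sum_(s < m.+1) tmono a (b + Posz s) x * (teval (p`_s)%:P x / teval p x) =
  tmono a b x * (\sum_(s < m.+1) (p`_s).[torus_pt x.1] * torus_pt x.2 ^+ s) / teval p x.
  rewrite mulr_sumr mulr_suml; apply: eq_bigr => s _.
  rewrite tevalC -[b + _ in LHS]/(b + Posz s) -{1}[a]addr0 -tmonoD /tmono expr0z mul1r.
  by rewrite -exprnP; ring.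
rewrite -(eval2_coef _ _ pm) -/(teval p x) mulfK //.
exact: (teval_neq0 sp).
Qed.

(** Dividing the conjugate of [cdnum] by p conj(p) cancels one factor in each of its two halves: one
    keeps 1/p, the other conj(1/p), and each then has its own vanishing rule. *)
Lemma dual_integrand (i l : int) (k j : nat) (x : TT) : D x -> (j <= m)%N ->
  tmono i l x * conjc (dual k j x) * (wt p x)%:C%C =
  tmono (i - k%:Z - n%:Z) (l - j%:Z) x +
  ((-1) * (\sum_(j.+1 <= s < m.+1) tmono (i - k%:Z - n%:Z) (l - j%:Z + s%:Z) x *
            (teval (p`_s)%:P x / teval p x)) +
  (-1) * (\sum_(s < j.+1) tmono (i - k%:Z - n%:Z) (l - j%:Z + s%:Z - m%:Z) x *
            conjc (teval (p`_(m - s))%:P x / teval p x))).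
Proof.
move=> Dx jm; rewrite !mulN1r addrA -(@partial_quotient_sum j) // -sumrB.
rewrite /dual /cdpoly /teval eval2_sum !conjcM conjc_sum.
rewrite mulrA mulr_sumr mulr_suml; apply: eq_bigr => s _.
have sj : (s <= j)%N by rewrite -ltnS.
rewrite eval2M eval2Xn (cdnum_torus pn pm) ?sqn_torus_pt //.
rewrite -!/(teval _ _) !tevalC wtC.
have -> : torus_pt x.2 ^+ (j - s) = tmono 0 (j%:Z - s%:Z) x.
  by rewrite /tmono expr0z mul1r subzn.
have -> : torus_pt x.1 ^+ n = tmono n%:Z 0 x by rewrite /tmono expr0z mulr1.
have -> : torus_pt x.2 ^+ m = tmono 0 m%:Z x by rewrite /tmono expr0z mul1r.
have e1 : tmono (i - k%:Z - n%:Z) (l - j%:Z + s%:Z) x =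
  tmono i l x * conjc (tmono k%:Z 0 x) * conjc (tmono n%:Z 0 x) * conjc (tmono 0 (j%:Z - s%:Z) x).
  by rewrite !tmono_conj !tmonoD; congr tmono; lia.
have e2 : tmono (i - k%:Z - n%:Z) (l - j%:Z + s%:Z - m%:Z) x =
  tmono i l x * conjc (tmono k%:Z 0 x) * conjc (tmono n%:Z 0 x) * conjc (tmono 0 (j%:Z - s%:Z) x) *
  conjc (tmono 0 m%:Z x).
  by rewrite !tmono_conj !tmonoD; congr tmono; lia.
rewrite e1 e2.
have P0 := teval_neq0 sp Dx.
have P0' : conjc (teval p x) != 0 by rewrite conjc_eq0.
rewrite -/(teval p x) !conjcM !conjcB !conjcM !conjcK conjc_inv.
move: P0 P0'.
by move: (teval p x) (conjc (teval p x)) => P P' P0 P0'; field; rewrite P0 P0'.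
Qed.

(** The case i < n, with any l >= 0, serves the orthogonality to the half-plane span; the case l <
    m, with any i, serves the extraction of coefficients. *)
Lemma tip_tmono_dual (i l : int) (k j : nat) : (j < m)%N -> 0 <= l ->
  i < n%:Z \/ l < m%:Z ->
  tip p (tmono i l) (dual k j) = ((i == (n + k)%N%:Z) && (l == j%:Z))%:R.
Proof.
move=> jm l0 il; rewrite /tip (eq_cint (fun x Dx => dual_integrand i l k Dx (ltnW jm))).
set c := i - k%:Z - n%:Z.
have i1 (s : nat) : cintegrable (fun x : TT => tmono c (l - j%:Z + s%:Z) x * (teval (p`_s)%:P x / teval p x)).
  exact: cintegrable_tmono_quotient.
have i2 (s : nat) : cintegrable (fun x : TT => tmono c (l - j%:Z + s%:Z - m%:Z) x *
            conjc (teval (p`_(m - s))%:P x / teval p x)).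
  exact: cintegrable_tmono_conj_quotient.
rewrite cintD; last 2 first.
- exact: cintegrable_tmono.
- by apply: cintegrableD; apply: cintegrableZ; apply: cintegrable_sum => s _.
rewrite cintD; last 2 first.
- by apply: cintegrableZ; apply: cintegrable_sum => s _.
- by apply: cintegrableZ; apply: cintegrable_sum => s _.
rewrite !cintZ; last 2 first.
- by apply: cintegrable_sum => s _.
- by apply: cintegrable_sum => s _.
rewrite !cint_sum //.
(* Here the w-exponent l - j + s is positive, as l >= 0 and s > j. *)
rewrite big_nat big1 => [|s /andP[js sm]]; last first.
  by apply: cint_quotient_eq0 => //; right; lia.
(* If i < n, the z-exponent i - k - n is negative; if l < m, the w-exponent l - j + s - m is,
   because s <= j. *)
rewrite big1 => [|s _]; last first.
  apply: cint_conj_quotient_eq0 => //; have := ltn_ord s; rewrite /c.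
  by case: il => h; [left|right]; lia.
rewrite !mulr0 !addr0 cint_tmono; congr (_%:R); congr (nat_of_bool (_ && _)).
  by rewrite /c; apply/eqP/eqP; lia.
by rewrite subr_eq0.
Qed.

End DualBasis.

(** * Closed spans *)

Section Coefficients.
Context {R : realType}.
Notation TT := (measurableTypeR R * measurableTypeR R)%type.
Notation D := (tdom R : set TT).
Variable (p : {poly {poly R[i]}}).
Hypothesis sp : stable p.

(** The bound [M] on the w-size is there because [dual] detects single coefficients only among
    monomials with w-exponent below m. *)
Lemma tip_teval_coef (q : {poly {poly R[i]}}) (M i v : nat) (f : TT -> R[i]) :
  l2 p f -> (size q <= M)%N -> (v < M)%N ->
  (forall u w : nat, (w < M)%N -> tip p (tmono u w) f = ((u == i) && (w == v))%:R) ->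
  tip p (teval q) f = q`_v`_i.
Proof.
move=> lf qM vM H; have [N0 qN] := coef_sizes_bounded 1 (fun=> q).
pose N := maxn N0 i.+1.
have iN : (i < N)%N by rewrite leq_maxr.
have -> : teval q = (fun x => \sum_(w < M) \sum_(u < N) q`_w`_u * tmono u w x).
  apply/funext => x; apply: teval_expand => // j _.
  by apply: leq_trans (qN 0%N j isT) _; exact: leq_maxl.
have lt (u w : nat) : l2 p (fun x => q`_w`_u * tmono (u : int) (w : int) x).
  exact: (l2Z _ (l2_tmono sp _ _)).
rewrite tip_suml //; last by move=> w _; apply: l2_sum => // u _; exact: lt.
have E (w : 'I_M) : tip p (fun x => \sum_(u < N) q`_w`_u * tmono u w x) f =
    (w == v :> nat)%:R * q`_v`_i.
  rewrite tip_suml //; rewrite (bigD1 (Ordinal iN)) //= big1 ?addr0 => [|u ui].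
    rewrite tipZl //; last exact: l2_tmono.
    rewrite H // eqxx /=; case: eqP => [->|_]; by rewrite ?mulr1 ?mul1r ?mulr0 ?mul0r.
  rewrite tipZl //; last exact: l2_tmono.
  rewrite H //; case: eqP => [ei|_]; last by rewrite mulr0.
  by case/eqP: ui; apply: val_inj.
rewrite (eq_bigr _ (fun w _ => E w)) (bigD1 (Ordinal vM)) //= eqxx mul1r big1 ?addr0 //.
move=> w wv; case: eqP => [ew|_]; last by rewrite mul0r.
by case/eqP: wv; apply: val_inj.
Qed.

(* The weight cancels: pairing against z^i w^v |p|^2 extracts a Fourier coefficient. *)
Lemma coef_bound : exists2 C : R, 0 < C & forall (q : {poly {poly R[i]}}) (i v : nat),
  cabs (q`_v`_i) <= C * tnorm p (teval q).
Proof.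
pose g (i v : nat) (x : TT) := tmono i v x * (teval p x * conjc (teval p x)).
have lg i v : l2 p (g i v).
  apply: l2_bounded => //.
    apply: cmeasM; first exact: cmeas_tmono.
    by apply: cmeasM; [|apply: cmeas_conj]; exact: cmeas_teval.
  apply: tboundedM; first by apply: tbounded_unimodular => x; exact: cabs_tmono.
  by apply: tboundedM; [|apply: tbounded_conj]; exact: tbounded_teval.
(* Characters have modulus 1, so one constant serves all coefficients. *)
have ng i v : tnorm p (g i v) = tnorm p (g 0%N 0%N).
  congr Num.sqrt; apply: eq_Rintegral => x _; congr (_ * _).
  by rewrite -!sqr_cabs cabsM [in RHS]cabsM !cabs_tmono.
exists (tnorm p (g 0%N 0%N) + 1) => [|q i v]; first by rewrite ltr_wpDl ?tnorm_ge0.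
have <- : tip p (teval q) (g i v) = q`_v`_i.
  apply: (@tip_teval_coef q (maxn (size q) v.+1)) => //; rewrite ?leq_maxl ?leq_maxr //.
  move=> u w _; rewrite /tip (@eq_cint _ _ (tmono (u%:Z - i%:Z) (w%:Z - v%:Z))).
    by rewrite cint_tmono !subr_eq0.
  move=> x Dx; have P0 := teval_neq0 sp Dx.
  have P0' : conjc (teval p x) != 0 by rewrite conjc_eq0.
  rewrite /g wtC conjcM tmono_conj conjcM conjcK -tmonoD.
  by field; rewrite P0 P0'.
apply: le_trans (cauchy_schwarz (l2_teval sp q) (lg i v)) _.
by rewrite ng mulrC ler_wpM2r ?tnorm_ge0 // lerDl.
Qed.

Lemma tnorm_tmono a b : tnorm p (tmono a b) = tnorm p (tmono 0 0).
Proof.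
congr Num.sqrt; apply: eq_Rintegral => x _; congr (_ * _).
by rewrite -!sqr_cabs !cabs_tmono.
Qed.

End Coefficients.

Section Spans.
Context {R : realType}.
Notation TT := (measurableTypeR R * measurableTypeR R)%type.
Variable (p : {poly {poly R[i]}}).
Hypothesis sp : stable p.
Implicit Types (S : set (R[i] -> R[i] -> R[i])) (F G : R[i] -> R[i] -> R[i]).
Notation lft := (@Defs.lift R).

Lemma lspan_gen S G : S G -> lspan S G.
Proof.
move=> SG; exists 1%N, (fun=> 1), (fun=> G); split => //.
by apply/funext => z; apply/funext => w; rewrite big_ord1 mul1r.
Qed.

Lemma lspanZ S c G : lspan S G -> lspan S (fun z w => c * G z w).
Proof.
move=> [k [d [g [Sg ->]]]]; exists k, (fun i => c * d i), g; split => //.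
apply/funext => z; apply/funext => w; rewrite mulr_sumr.
by apply: eq_bigr => i _; rewrite mulrA.
Qed.

Lemma lspanD S F G : lspan S F -> lspan S G -> lspan S (fun z w => F z w + G z w).
Proof.
move=> [k [d [g [Sg ->]]]] [k' [d' [g' [Sg' ->]]]].
exists (k + k')%N, (fun i => match fintype.split i with inl a => d a | inr a => d' a end),
  (fun i => match fintype.split i with inl a => g a | inr a => g' a end); split.
  by move=> i; case: (fintype.split i).
apply/funext => z; apply/funext => w; rewrite big_split_ord /=; congr (_ + _).
  apply: eq_bigr => i _; case: fintype.splitP => j /= e; last by have := ltn_ord i; rewrite e ltnNge leq_addr.
  by have -> : i = j by apply: val_inj.
apply: eq_bigr => i _; case: fintype.splitP => j /= e.
  by have := ltn_ord j; rewrite -e ltnNge leq_addr.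
by have -> : i = j by apply: val_inj; move/eqP: e; rewrite eqn_add2l => /eqP.
Qed.

Lemma lspan0 S : lspan S (fun _ _ => 0).
Proof.
exists 0%N, (fun=> 0), (fun _ _ _ => 0); split; first by case.
by apply/funext => z; apply/funext => w; rewrite big_ord0.
Qed.

Lemma lspan_sum (I : Type) (r : seq I) (P : pred I) S (F : I -> R[i] -> R[i] -> R[i]) :
  (forall i, P i -> lspan S (F i)) -> lspan S (fun z w => \sum_(i <- r | P i) F i z w).
Proof.
move=> SF; elim: r => [|i r IH].
  have -> : (fun z w => \sum_(i <- [::] | P i) F i z w) = (fun _ _ => 0).
    by apply/funext => z; apply/funext => w; rewrite big_nil.
  exact: lspan0.
have -> : (fun z w => \sum_(j <- i :: r | P j) F j z w) =
  if P i then (fun z w => F i z w + \sum_(j <- r | P j) F j z w)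
  else (fun z w => \sum_(j <- r | P j) F j z w).
  by apply/funext => z; apply/funext => w; rewrite big_cons; case: (P i).
by have [Pi|_] := boolP (P i) => //; apply: lspanD => //; exact: SF.
Qed.

Definition l2set S := forall G, S G -> l2 p (lft G).

Lemma l2_lspan S G : l2set S -> lspan S G -> l2 p (lft G).
Proof.
move=> lS [k [c [g [Sg ->]]]].
have -> : lft (fun z w => \sum_(i < k) c i * g i z w) = (fun x => \sum_(i < k) c i * lft (g i) x) by [].
by apply: l2_sum => // i _; apply: l2Z; exact/lS/Sg.
Qed.

Lemma cspan_l2 S F : cspan p S F -> l2 p (lft F).
Proof. by move=> [/L2P]. Qed.

Lemma cspan_approx S F (eps : R) : cspan p S F -> 0 < eps ->
  exists2 G, lspan S G & tnorm p (fun x => lft F x - lft G x) <= eps.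
Proof.
move=> [_ SF] e0; have [G [SG FG]] := SF (eps ^+ 2) (exprn_gt0 2 e0).
exists G => //; rewrite -(@ler_pXn2r _ 2) ?nnegrE ?tnorm_ge0 ?(ltW e0) // sqr_tnorm.
exact: ltW.
Qed.

Lemma lspan_sub_cspan S G : l2set S -> lspan S G -> cspan p S G.
Proof.
move=> lS SG; split; first by apply/L2P; exact: l2_lspan SG.
move=> e e0; exists G; split => //; rewrite nsqE.
have -> : lft (fun z w => G z w - G z w) = (fun=> 0).
  by apply/funext => x; rewrite /lft subrr.
suff -> : tnsq p (fun=> 0) = 0 by [].
by apply: (@complexI R); rewrite -tip_self tip0l.
Qed.

Lemma tip_lspan_eq0 S1 S2 F G : l2set S1 -> l2set S2 ->
  (forall F G, S1 F -> S2 G -> tip p (lft F) (lft G) = 0) ->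
  lspan S1 F -> lspan S2 G -> tip p (lft F) (lft G) = 0.
Proof.
move=> lS1 lS2 H SF SG; have lG := l2_lspan lS2 SG.
case: SF => k [c [f [Sf ->]]].
have -> : lft (fun z w => \sum_(i < k) c i * f i z w) = (fun x => \sum_(i < k) c i * lft (f i) x) by [].
rewrite tip_suml //; last by move=> i _; apply: l2Z; exact/lS1/Sf.
rewrite big1 // => i _; rewrite tipZl //; last exact/lS1/Sf.
case: SG lG => k' [c' [g [Sg ->]]] _.
have -> : lft (fun z w => \sum_(i < k') c' i * g i z w) = (fun x => \sum_(i < k') c' i * lft (g i) x) by [].
rewrite tip_sumr //; [|by move=> j _; apply: l2Z; exact/lS2/Sg|exact/lS1/Sf].
rewrite big1 ?mulr0 // => j _; rewrite tipZr // ?H ?mulr0 //; [exact/lS2/Sg|exact/lS1/Sf].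
Qed.

Lemma ip_cspan_eq0 S1 S2 F G : l2set S1 -> l2set S2 ->
  (forall F G, S1 F -> S2 G -> tip p (lft F) (lft G) = 0) ->
  cspan p S1 F -> cspan p S2 G -> ip p F G = 0.
Proof.
move=> lS1 lS2 H cF cG; rewrite ipE; apply: eq0_cabs => e e0.
have lF := cspan_l2 cF; have lG := cspan_l2 cG.
have pos f : 0 < tnorm p f + 1 by rewrite ltr_wpDl ?tnorm_ge0.
have e20 : 0 < e / 2 by rewrite divr_gt0.
have [F' SF' FF'] := cspan_approx cF (divr_gt0 e20 (pos (lft G))).
(* The tolerance for G' involves the norm of F', hence the order of choice; adding 1 keeps the
   denominators positive. *)
have [G' SG' GG'] := cspan_approx cG (divr_gt0 e20 (pos (lft F'))).
have lF' := l2_lspan lS1 SF'; have lG' := l2_lspan lS2 SG'.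
have -> : tip p (lft F) (lft G) = tip p (fun x => lft F x - lft F' x) (lft G) +
    tip p (lft F') (fun x => lft G x - lft G' x).
  rewrite tipBl // tipBr // (tip_lspan_eq0 lS1 lS2 H SF' SG') subr0.
  by rewrite subrK.
rewrite [leRHS](splitr e); apply: le_trans (cabsD _ _) _; apply: lerD.
  apply: le_trans (cauchy_schwarz _ lG) _; first exact: l2B.
  rewrite -[leRHS](@divfK _ (tnorm p (lft G) + 1)) ?gt_eqF //.
  by rewrite ler_pM ?tnorm_ge0 // lerDl.
apply: le_trans (cauchy_schwarz lF' _) _; first exact: l2B.
rewrite -[leRHS](@divfK _ (tnorm p (lft F') + 1)) ?gt_eqF // mulrC.
by rewrite ler_pM ?tnorm_ge0 // lerDl.
Qed.

(** Spans consist of functions on all of C x C, whereas a_j is identified with a polynomial only on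
    the torus. Generators are therefore compared after [lift]. *)
Lemma lspan_lift_sub S1 S2 G :
  (forall G, S1 G -> exists2 G', lspan S2 G' & lft G' = lft G) ->
  lspan S1 G -> exists2 G', lspan S2 G' & lft G' = lft G.
Proof.
move=> H [k [c [g [Sg ->]]]].
have /choice[g' g'P] : forall i, exists G', lspan S2 G' /\ lft G' = lft (g i).
  by move=> i; have [G' ? ?] := H _ (Sg i); exists G'.
exists (fun z w => \sum_(i < k) c i * g' i z w).
  by apply: lspan_sum => i _; apply: lspanZ; exact: (g'P i).1.
apply/funext => x; apply: eq_bigr => i _; congr (_ * _).
exact: (congr1 (@^~ x) (g'P i).2).
Qed.

Lemma cspan_lift_sub S1 S2 F :
  (forall G, S1 G -> exists2 G', lspan S2 G' & lft G' = lft G) ->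
  cspan p S1 F -> cspan p S2 F.
Proof.
move=> H [lF cF]; split => // e /cF[G [SG FG]].
have [G' SG' GG'] := lspan_lift_sub H SG.
exists G'; split => //; rewrite nsqE.
suff -> : lft (fun z w => F z w - G' z w) = lft (fun z w => F z w - G z w) by [].
by apply/funext => x; rewrite /lft -[G' _ _]/(lft G' x) GG'.
Qed.

End Spans.

(** * Density of the z^k a_j in the orthogonal complement *)

Section Density.
Context {R : realType}.
Notation TT := (measurableTypeR R * measurableTypeR R)%type.
Notation lft := (@Defs.lift R).
Variables (n m : nat) (p : {poly {poly R[i]}}).
Hypotheses (pn : forall j, (size (p`_j)%R <= n.+1)%N) (pm : (size p <= m.+1)%N).
Hypothesis sp : stable p.
Notation dual := (dual n m p).

Lemma tip_teval_dual (q : {poly {poly R[i]}}) k j : (size q <= m)%N -> (j < m)%N ->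
  tip p (teval q) (dual k j) = q`_j`_(n + k).
Proof.
move=> qm jm; apply: (@tip_teval_coef _ _ sp _ m) => //; first exact: l2_dual.
by move=> u w wm; rewrite tip_tmono_dual //; right.
Qed.

(** [dual] as a polynomial, so that a residual of a polynomial again has coefficients to inspect. *)
Definition dualpoly (k j : nat) : {poly {poly R[i]}} := ('X^k)%:P * cdpoly n m p j.

Lemma teval_dualpoly k j : teval (dualpoly k j) = dual k j.
Proof.
apply/funext => x; rewrite /teval eval2M eval2C hornerXn.
by rewrite /dual /tmono expr0z mulr1.
Qed.

Lemma size_dualpoly k j : (j < m)%N -> (size (dualpoly k j) <= m)%N.
Proof.
move=> jm; rewrite /dualpoly mul_polyC; apply: leq_trans (size_scale_leq _ _) _.
exact: size_cdpoly.
Qed.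

Lemma coef_dualpoly_size k j v (d : nat) : (size ((cdpoly n m p j)`_v)%R <= d)%N ->
  (size ((dualpoly k j)`_v)%R <= k + d)%N.
Proof.
move=> sd; rewrite /dualpoly coefCM mulrC.
have [->|c0] := eqVneq ((cdpoly n m p j)`_v) 0; first by rewrite mul0r size_poly0.
by rewrite size_mulXn // leq_add2l.
Qed.

(* The residual of q modulo the span of the z^k a_j, k < N, has no z-frequency in
   [n, n + N); what is left are frequencies below n, where F - q is small, and high ones. *)
Lemma dual_residual_small (F : TT -> R[i]) (eps : R) : l2 p F ->
  (forall i j : nat, (i < n)%N -> (j < m)%N -> tip p F (tmono i j) = 0) ->
  (forall d : R, 0 < d -> exists2 q : {poly {poly R[i]}}, (size q <= m)%N &
     tnorm p (fun x => F x - teval q x) <= d) ->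
  0 < eps -> (0 < m)%N ->
  exists (N : nat) (c : nat -> R[i]),
    tnorm p (fun x => F x - \sum_(t < N * m) c t * dual (t %/ m) (t %% m) x) <= eps.
Proof.
move=> lF Forth Fapp e0 m0.
have [C C0 Cb] := coef_bound sp.
have [d0 d0P] := coef_sizes_bounded m (cdpoly n m p).
(* The number of frequencies that can survive, n low and d0 high ones for each power of w, times the
   bound [C] on coefficients. *)
pose K : R := m%:R * (n%:R + d0%:R) * C.
have K0 : 0 <= K by rewrite /K !mulr_ge0 ?addr_ge0 // ltW.
pose B := tnorm p (tmono (R := R) 0 0).
have B0 : 0 <= B by exact: tnorm_ge0.
(* Chosen so that K eta <= eps / 2. *)
pose eta := eps / 2 / (K + 1).
have K1 : 0 < K + 1 by rewrite ltr_wpDl.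
have B1 : 0 < B + 1 by rewrite ltr_wpDl.
have eta0 : 0 < eta by rewrite !divr_gt0.
(* The first term is the share of F - q in the final error; the second makes the pairings of F - q
   with characters, which have norm [B], at most [eta]. *)
pose del := Num.min (eps / 2) (eta / (B + 1)).
have del0 : 0 < del by rewrite lt_min !divr_gt0.
have [q qm Fq] := Fapp _ del0.
have lq : l2 p (teval q) by exact: l2_teval.
have [i0 RL] := riemann_lebesgue sp q eta0.
have [k0 k0P] := coef_sizes_bounded 1 (fun=> q).
(* [i0] makes the pairings of q with z-frequencies from [N] on small; [k0] puts all z-frequencies of
   q below [N]. *)
pose N := maxn i0 k0.
have ld t : l2 p (dual (t %/ m) (t %% m)) by exact: l2_dual.
(* The pair (k, j) with k < N and j < m is encoded as t = k m + j. *)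
have [c cP] := residual_exists sp (N * m) ld lq.
exists N, c.
set S := (fun x => \sum_(t < N * m) c t * dual (t %/ m) (t %% m) x).
set r := (fun x => teval q x - S x).
have lS : l2 p S by apply: l2_sum => // t _; exact: l2Z.
have lr : l2 p r by exact: l2B.
have rS : tip p r S = 0.
  rewrite tip_sumr //; last by move=> t _; exact: l2Z.
  by rewrite big1 // => t _; rewrite tipZr // cP ?mulr0.
pose Q := q - \sum_(t < N * m) (c t)%:P%:P * dualpoly (t %/ m) (t %% m).
have rQ : r = teval Q.
  apply/funext => x; rewrite /r /S /teval /Q eval2D eval2N eval2_sum; congr (_ - _).
  by apply: eq_bigr => t _; rewrite eval2M !eval2C hornerC -teval_dualpoly.
have Qm : (size Q <= m)%N.
  apply: leq_trans (size_polyD _ _) _; rewrite geq_max qm size_polyN.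
  apply: leq_trans (size_sum _ _ _) _; apply/bigmax_leqP => t _.
  rewrite mul_polyC; apply: leq_trans (size_scale_leq _ _) _.
  by apply: size_dualpoly; rewrite ltn_mod.
have QN v : (size (Q`_v)%R <= n + N + d0)%N.
  rewrite /Q coefB coef_sum.
  apply: leq_trans (size_polyD _ _) _; rewrite geq_max size_polyN; apply/andP; split.
    apply: leq_trans (k0P 0%N v isT) _; rewrite /N; lia.
  apply: leq_trans (size_sum _ _ _) _; apply/bigmax_leqP => t _.
  rewrite coefCM mul_polyC; apply: leq_trans (size_scale_leq _ _) _.
  have tm : (t %% m < m)%N by rewrite ltn_mod.
  apply: leq_trans (coef_dualpoly_size _ (d0P _ v tm)) _.
  have : (t %/ m < N)%N by rewrite ltn_divLR.
  by lia.
(* This coefficient is the pairing of the residual with z^k a_v. *)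
have Q0 k v : (k < N)%N -> (v < m)%N -> Q`_v`_(n + k) = 0.
  move=> kN vm; rewrite -(tip_teval_dual k Qm vm) -rQ.
  have tN : (k * m + v < N * m)%N.
    have : (k.+1 * m <= N * m)%N by rewrite leq_mul2r kN orbT.
    by rewrite mulSn; lia.
  have := cP _ tN; rewrite modnMDl modn_small // divnMDl // divn_small // addn0.
  exact.
(* The residual is orthogonal to [S], so one of its two occurrences may be replaced by q, which does
   not depend on [N]. *)
have rr : (tnsq p r)%:C%C = tip p (teval Q) (teval q).
  rewrite -tip_self -{2}[r]/(fun x => teval q x - S x) tipBr // rS subr0.
  by rewrite rQ.
set s := tnorm p r.
have low (u v : nat) : (u < n)%N -> (v < m)%N -> cabs (tip p (tmono u v) (teval q)) <= eta.
  move=> un vm.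
  (* This is where the orthogonality of F to the low monomials enters. *)
  have -> : tip p (tmono u v) (teval q) = - tip p (tmono u v) (fun x => F x - teval q x).
    rewrite tipBr //; last exact: l2_tmono.
    by rewrite (tipC lF (l2_tmono sp _ _)) Forth // conjc0 sub0r opprK.
  rewrite cabsN; apply: le_trans (cauchy_schwarz (l2_tmono sp _ _) _) _; first exact: l2B.
  rewrite tnorm_tmono -/B.
  apply: (@le_trans _ _ (B * (eta / (B + 1)))).
    by rewrite ler_wpM2l // (le_trans Fq) // ge_min lexx orbT.
  rewrite mulrCA -[leRHS]mulr1 ler_pM2l // ler_pdivrMr // mul1r lerDl //.
have term (u v : nat) : cabs (tip p (tmono u v) (teval q)) <= eta ->
    cabs (Q`_v`_u * tip p (tmono u v) (teval q)) <= C * s * eta.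
  move=> h; rewrite cabsM ler_pM ?cabs_ge0 // /s rQ; exact: Cb.
have sK : s ^+ 2 <= K * eta * s.
  have -> : s ^+ 2 = cabs (tip p (teval Q) (teval q)).
    by rewrite -rr cabs_real ger0_norm ?tnsq_ge0 // /s sqr_tnorm.
  have -> : teval Q = (fun x => \sum_(v < m) \sum_(u < n + N + d0) Q`_v`_u * tmono u v x).
    by apply/funext => x; apply: teval_expand => // j _; exact: QN.
  have lt (u v : nat) : l2 p (fun x : TT => Q`_v`_u * tmono (u : int) (v : int) x).
    exact: (l2Z _ (l2_tmono sp _ _)).
  rewrite tip_suml //; last by move=> v _; apply: l2_sum => // u _; exact: lt.
  apply: le_trans (cabs_sum _ _ _) _.
  have -> : K * eta * s = \sum_(v < m) ((n%:R + d0%:R) * (C * s * eta)).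
    by rewrite sumr_const card_ord -mulr_natl /K; ring.
  apply: ler_sum => v _; rewrite tip_suml //.
  apply: le_trans (cabs_sum _ _ _) _.
  (* The z-frequencies split into blocks of lengths n, N and d0; by [Q0] the middle one is empty. *)
  rewrite big_split_ord /= big_split_ord /= [X in _ + X + _]big1 ?addr0; last first.
    move=> u _; rewrite tipZl //; last exact: l2_tmono.
    by rewrite Q0 // mul0r cabs0.
  rewrite mulrDl; apply: lerD.
    have -> : n%:R * (C * s * eta) = \sum_(u < n) (C * s * eta).
      by rewrite sumr_const card_ord mulr_natl.
    apply: ler_sum => u _; rewrite tipZl //; last exact: l2_tmono.
    by apply: term; exact: low.
  have -> : d0%:R * (C * s * eta) = \sum_(u < d0) (C * s * eta).
    by rewrite sumr_const card_ord mulr_natl.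
  apply: ler_sum => u _; rewrite tipZl //; last exact: l2_tmono.
  apply: term; apply: RL; rewrite /N; lia.
have s0 : 0 <= s by exact: tnorm_ge0.
have sKe : s <= K * eta.
  have [->|sn] := eqVneq s 0; first by rewrite mulr_ge0 // ltW.
  by move: sK; rewrite expr2 ler_pM2r // lt0r sn.
have -> : (fun x => F x - S x) = (fun x => (F x - teval q x) + r x).
  by apply/funext => x; rewrite /r; ring.
apply: le_trans (tnorm_triangle _ lr) _; first exact: l2B.
rewrite [leRHS](splitr eps); apply: lerD.
  by rewrite (le_trans Fq) // ge_min lexx.
apply: le_trans sKe _; rewrite /eta mulrCA -[leRHS]mulr1 ler_pM2l ?divr_gt0 //.
by rewrite ler_pdivrMr // mul1r lerDl.
Qed.

End Density.

(** * Passage between polynomials and spans, and the theorem *)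

Section Assembly.
Context {R : realType}.
Notation TT := (measurableTypeR R * measurableTypeR R)%type.
Notation lft := (@Defs.lift R).
Variables (n m : nat) (p : {poly {poly R[i]}}).

Lemma degz_bound : degz p = n -> forall j, (size (p`_j)%R <= n.+1)%N.
Proof.
move=> <- j; have [sj|sj] := leqP (size p) j; first by rewrite (nth_default _ sj) size_poly0.
rewrite -[leqLHS]/(size (p`_j)%R); apply: leq_trans (leqSpred _) _; rewrite ltnS /degz.
exact: (leq_bigmax (Ordinal sj)).
Qed.

Lemma degw_bound : degw p = m -> (size p <= m.+1)%N.
Proof. by move=> <-; exact: leqSpred. Qed.

Lemma lift_zpow_wpow (i : int) (j : nat) : lft (fun z w => z ^ i * w ^ j) = tmono i j.
Proof. by []. Qed.

Lemma teval_lspan (S : set (R[i] -> R[i] -> R[i])) (q : {poly {poly R[i]}}) : (size q <= m)%N ->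
  (forall i j : nat, (j < m)%N -> S (fun z w => z ^+ i * w ^+ j)) ->
  exists2 G, lspan S G & lft G = teval q.
Proof.
move=> qm HS; have [N qN] := coef_sizes_bounded 1 (fun=> q).
exists (fun z w => \sum_(j < m) \sum_(i < N) q`_j`_i * (z ^+ i * w ^+ j)); last first.
  apply/funext => x; rewrite (@teval_expand _ _ m N) // => j _; exact: (qN 0%N j).
apply: lspan_sum => j _; apply: lspan_sum => i _; apply: lspanZ; apply: lspan_gen.
exact: HS.
Qed.

Lemma lspan_teval (S : set (R[i] -> R[i] -> R[i])) G :
  (forall H, S H -> exists i j : nat, (j < m)%N /\ H = (fun z w => z ^+ i * w ^+ j)) ->
  lspan S G -> exists2 q : {poly {poly R[i]}}, (size q <= m)%N & lft G = teval q.
Proof.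
move=> HS [k [c [g [Sg ->]]]].
have /choice[e eP] : forall t, exists ij : nat * nat,
    (ij.2 < m)%N /\ g t = (fun z w => z ^+ ij.1 * w ^+ ij.2).
  by move=> t; have [i [j [jm gE]]] := HS _ (Sg t); exists (i, j).
exists (\sum_(t < k) (c t)%:P%:P * (('X^((e t).1))%:P * 'X^((e t).2))).
  apply: leq_trans (size_sum _ _ _) _; apply/bigmax_leqP => t _.
  rewrite !mul_polyC; do 2?[apply: leq_trans (size_scale_leq _ _) _].
  by rewrite size_polyXn; exact: (eP t).1.
apply/funext => x; rewrite /teval eval2_sum; apply: eq_bigr => t _.
by rewrite !eval2M !eval2C hornerC hornerXn eval2Xn (eP t).2.
Qed.

End Assembly.

Theorem mainTheorem6 (R : realType) (n m : nat) (p : {poly {poly R[i]}})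
    (a : nat -> R[i] -> R[i] -> R[i]) :
  (0 < n)%N -> (0 < m)%N -> degz p = n -> degw p = m -> stable p ->
  (* a_0, ..., a_{m-1} defined by L(z,w;eta) = \sum_{j<m} a_j(z,w) conj(eta)^j *)
  (forall z w eta : R[i], z != 0 -> w != 0 -> eta != 0 -> w * conjc eta != 1 ->
     \sum_(j < m) a j z w * (conjc eta) ^+ j =
     z ^+ n * (eval2 p z w * conjc (eval2 p (conjc z)^-1 eta)
               - ptilde n m p z w * conjc (ptilde n m p (conjc z)^-1 eta))
       / (1 - w * conjc eta)) ->
  cspan p [set F | exists i j : nat, (j < m)%N /\ F = (fun z w => z ^+ i * a j z w)]
  = [set F | cspan p [set G | exists i j : nat, (j < m)%N /\ G = (fun z w => z ^+ i * w ^+ j)] F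
             /\ forall G, lspan [set H | exists i j : nat, (i < n)%N /\ (j < m)%N /\
                                   H = (fun z w => z ^+ i * w ^+ j)] G ->
                          ip p F G = 0]
  /\ (forall F G,
        cspan p [set H | exists i j : nat, (j < m)%N /\ H = (fun z w => z ^+ i * a j z w)] F ->
        cspan p [set H | exists (i : int) (j : nat), (i < n%:Z) /\
                           H = (fun z w => z ^ i * w ^+ j)] G ->
        ip p F G = 0).
Proof.
move=> n0 m0 /degz_bound pn /degw_bound pm sp aL.
set X := [set F | exists i j : nat, (j < m)%N /\ F = (fun z w => z ^+ i * a j z w)].
set Y := [set G | exists i j : nat, (j < m)%N /\ G = (fun z w => z ^+ i * w ^+ j)].
set W := [set H | exists i j : nat, (i < n)%N /\ (j < m)%N /\ H = (fun z w => z ^+ i * w ^+ j)].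
set V := [set H | exists (i : int) (j : nat), (i < n%:Z) /\ H = (fun z w => z ^ i * w ^+ j)].
have Xdual i j : (j < m)%N -> Defs.lift (fun z w => z ^+ i * a j z w) = dual n m p i j.
  move=> jm; apply/funext => x; rewrite /Defs.lift (a_torus pn pm aL) ?sqn_torus_pt //.
  by rewrite /dual /tmono expr0z mulr1.
have lX : l2set p X by move=> _ [i [j [jm ->]]]; rewrite Xdual //; exact: l2_dual.
have lV : l2set p V by move=> _ [i [j [_ ->]]]; exact: (l2_tmono sp i j).
have lW : l2set p W by move=> _ [i [j [_ [_ ->]]]]; exact: (l2_tmono sp i j).
have orthV F G : X F -> V G -> tip p (Defs.lift F) (Defs.lift G) = 0.
  move=> [k [j [jm ->]]] [i [l [il ->]]]; rewrite Xdual // lift_zpow_wpow.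
  rewrite (tipC (l2_tmono sp _ _) (l2_dual _ _ sp _ _)) tip_tmono_dual //; last by left.
  (* The only nonzero pairing would need i = n + k, against i < n. *)
  rewrite (_ : (i == _) = false) ?conjc0 //; apply/negbTE/eqP => e; move: il; rewrite e.
  lia.
have part2 F G : cspan p X F -> cspan p V G -> ip p F G = 0 by exact: ip_cspan_eq0.
split => //; apply/seteqP; split => F.
  move=> XF; split.
    apply: cspan_lift_sub XF => _ [i [j [jm ->]]].
    rewrite Xdual // -teval_dualpoly; apply: (@teval_lspan _ m).
      exact: size_dualpoly.
    by move=> u v vm; exists u, v.
  (* The monomials of [W] are among those of [V], so this orthogonality is a case of the second
     claim. *)
  move=> G WG; apply: part2 XF _; apply: cspan_lift_sub (lspan_sub_cspan sp lW WG).
  move=> H [i [j [i_n [jm ->]]]]; exists (fun z w => z ^ i%:Z * w ^+ j) => //.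
  by apply: lspan_gen; exists i%:Z, j.
move=> [YF Worth]; have [LF _] := YF; split => // eps eps0.
have lF : l2 p (Defs.lift F) by apply/L2P.
(* [cspan] measures the squared norm with a strict inequality, and e^2 = eps / 4 < eps. *)
pose e := Num.sqrt eps / 2.
have se0 : 0 < Num.sqrt eps by rewrite sqrtr_gt0.
have e0 : 0 < e by rewrite divr_gt0.
have Forth (i j : nat) : (i < n)%N -> (j < m)%N -> tip p (Defs.lift F) (tmono i j) = 0.
  move=> i_n jm; rewrite -lift_zpow_wpow -ipE; apply: Worth.
  by apply: lspan_gen; exists i, j.
have Fapp (d : R) : 0 < d -> exists2 q : {poly {poly R[i]}}, (size q <= m)%N &
     tnorm p (fun x => Defs.lift F x - teval q x) <= d.
  move=> d0; have [G YG FG] := cspan_approx YF d0.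
  have [q qm Gq] : exists2 q : {poly {poly R[i]}}, (size q <= m)%N & Defs.lift G = teval q.
    by apply: lspan_teval YG => H [i [j [jm ->]]]; exists i, j.
  by exists q => //; rewrite -Gq.
have [N [c Fc]] := dual_residual_small pn pm sp lF Forth Fapp e0 m0.
exists (fun z w => \sum_(t < N * m) c t * (z ^+ (t %/ m) * a (t %% m)%N z w)); split.
  exists (N * m)%N, (fun t => c t), (fun t z w => z ^+ (t %/ m) * a (t %% m)%N z w); split => // t.
  by exists (t %/ m)%N, (t %% m)%N; rewrite ltn_mod.
rewrite nsqE -sqr_tnorm.
have -> : Defs.lift (fun z w => F z w - \sum_(t < N * m) c t * (z ^+ (t %/ m) * a (t %% m)%N z w)) =
  (fun x => Defs.lift F x - \sum_(t < N * m) c t * dual n m p (t %/ m) (t %% m) x).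
  apply/funext => x; congr (_ - _); apply: eq_bigr => t _; congr (_ * _).
  by rewrite -Xdual // ltn_mod.
apply: (@le_lt_trans _ _ (e ^+ 2)).
  by rewrite lerXn2r ?nnegrE ?tnorm_ge0 // ltW.
rewrite /e expr_div_n sqr_sqrtr ?ltW //; have := eps0; lra.
Qed.
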